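(* Let $K\ge2$, let $(a_t)_{t\in[0,1]}$ be balanced strategies (see context), and let $\phi:[0,1]\times\mathbb R^K\to\mathbb R$ be a classical solution of $$0\ \le\ \partial_t\phi(t,x)+\frac12\inf_{i\in[K]}\mathrm{Tr}\Big(D^2_{xx}\phi(t,x)\sum_{j\subset[K]}a_t(j)\big(\mathbf 1_{i\in j}e_{j^c}e_{j^c}^\top+\mathbf 1_{i\notin j}e_je_j^\top\big)\Big),\quad (t,x)\in[0,1)\times\mathbb R^K,$$ $$\phi(1,x)\le\max_i x^i,\qquad \phi(t,x+\lambda\mathbf 1)=\phi(t,x)+\lambda,$$ such that for some positive constant $C$, for all $(t,x)\in[0,1)\times\mathbb R^K$, $$|\partial^2_{tt}\phi(t,x)|\le\frac{C}{(1-t)^{3/2}},\qquad |\partial^3_{xxx}\phi(t,x)|+|\partial^2_{tx}\phi(t,x)|\le\frac{C}{1-t}.$$ Let $m_0$ be the initial belief. For each horizon $T$, let $\alpha^*$ be the adversary's strategy $\alpha^*_n=a_{t_n}$ with $t_n=\frac nT$, $n=0,\dots,T-1$. Then $\alpha^*$ yields regret bounded below by $\sqrt T\int\phi(0,x)\,m_0^{*\frac1{\sqrt T}}(dx)$ asymptotically; that is, $$\liminf_{T\to\infty}\left(\frac1{\sqrt T}\inf_{\beta\in\mathcal B}\gamma_T(0,m_0,\alpha^{*},\beta)-\int\phi(0,x)\,m_0^{*\frac1{\sqrt T}}(dx)\right)\ge0 .$$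
   Context: Notation: $[K]=\{1,\dots,K\}$; $\mathcal P(E)$: probability measures on $E$; elements of $\{0,1\}^K$ are identified with subsets $j\subset[K]$, $j^c=[K]\setminus j$; $e_1,\dots,e_K$ canonical basis of $\mathbb R^K$, $e_j=\sum_{i\in j}e_i$, $e=\mathbf 1=\sum_{i=1}^Ke_i$; $\lambda$ ranges over $\mathbb R$. A probability $a\in\mathcal P(\{0,1\}^K)$ is a balanced strategy if $\sum_{j:i\in j}a(j)$ does not depend on $i\in[K]$. For a measure $\mu$, $\int f\,d\mu^{*\lambda}=\int f(\lambda x)\mu(dx)$. Game with horizon $T$: $X_0\sim m_0\in\mathcal P(\mathbb R^K)$. At rounds $n=0,\dots,T-1$ the forecaster picks $b_n\in\mathcal P([K])$ and, independently, the adversary picks $a_n\in\mathcal P(\{0,1\}^K)$; $I_n\sim b_n$, $J_n\sim a_n$ are drawn independently; $X_{n+1}=X_n+e_{J_n}-\mathbf 1_{\{I_n\in J_n\}}e$; the signal is $Y_n=I_n$ if $I_n\in J_n$, $Y_n=-I_n$ otherwise. Before round $n$ both players know $h_n=(m_0,a_0,y_0,\dots,a_{n-1},y_{n-1})$ (the state is not observed). Strategies are sequences of measurable maps $h_n\mapsto\alpha_n(h_n)\in\mathcal P(\{0,1\}^K)$ (adversary, set $\mathcal A$) and $h_n\mapsto\beta_n(h_n)\in\mathcal P([K])$ (forecaster, set $\mathcal B$). The regret is $\gamma_T(0,m_0,\alpha,\beta)=\mathbb E^{m_0,\alpha,\beta}[\max_iX_T^i]$. *)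

(* Defs.v *)
From HB Require Import structures.
From mathcomp Require Import all_boot all_order all_algebra.
From mathcomp Require Import all_classical all_reals all_analysis.

Set Implicit Arguments.
Unset Strict Implicit.
Unset Printing Implicit Defensive.

Import Order.TTheory GRing.Theory Num.Theory.
Import numFieldNormedType.Exports.

Local Open Scope classical_set_scope.
Local Open Scope ring_scope.

(** Coordinates are indexed by ['I_K], i.e. from 0 instead of 1, and vectors
    of R^K are row vectors ['rV[R]_K].  Elements of {0,1}^K are represented by
    subsets [j : {set 'I_K}]. *)

Record fdist (R : realType) (A : finType) := FDist {
  fdist_val :> A -> R;
  fdist_ge0 : forall x, 0 <= fdist_val x;
  fdist_sum1 : \sum_x fdist_val x = 1 }.

Definition fdist_dirac (R : realType) (A : finType) (a : A) : fdist R A.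
Proof.
refine (@FDist R A (fun x => (x == a)%:R) (fun x => ler0n _ _) _).
rewrite (bigD1 a)//= eqxx big1 ?addr0// => x xa.
by rewrite (negbTE xa).
Defined.

HB.instance Definition _ (R : realType) (A : finType) :=
  gen_eqMixin (fdist R A).
HB.instance Definition _ (R : realType) (A : finType) :=
  gen_choiceMixin (fdist R A).
HB.instance Definition _ (R : realType) (K : nat) :=
  isPointed.Build (fdist R {set 'I_K}) (fdist_dirac R (finset.set0 : {set 'I_K})).

Section space.
Variables (R : realType) (K : nat).

(** R^K with its Borel sigma-algebra. *)
Definition RK : measurableType (@open 'rV[R]_K).-sigma :=
  g_sigma_algebraType (@open 'rV[R]_K).

Definition indic_vec (j : {set 'I_K}) : 'rV[R]_K := \row_i (i \in j)%:R.

Definition ones : 'rV[R]_K := const_mx 1.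

Definition maxcoord (x : 'rV[R]_K) : R := sup (range (fun i => x ord0 i)).

(** [int f dmu^{*l} = int f(l x) mu(dx)], valued in the extended reals. *)
Definition scaled_integral (mu : probability RK R) (l : R)
    (f : 'rV[R]_K -> R) : \bar R :=
  \int[mu]_x (f (l *: (x : 'rV[R]_K)))%:E.

Definition balanced (a : fdist R {set 'I_K}) : Prop :=
  forall i i' : 'I_K,
    \sum_(j : {set 'I_K} | i \in j) a j = \sum_(j : {set 'I_K} | i' \in j) a j.

End space.

(** * The repeated game *)

(** P({0,1}^K) with the sigma-algebra generated by the evaluations
    [p |-> p j], i.e. the Borel sigma-algebra of the simplex. *)
Definition fdist_eval_sets (R : realType) (K : nat) :
    set (set (fdist R {set 'I_K})) :=
  [set U | exists (j : {set 'I_K}) (B : set R),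
     measurable B /\ U = [set p : fdist R {set 'I_K} | B (p j)]].

Definition adv_action (R : realType) (K : nat) :
    measurableType (@fdist_eval_sets R K).-sigma :=
  g_sigma_algebraType (@fdist_eval_sets R K).

(** Signals are signed integers, with the discrete sigma-algebra. *)
Definition signal := int.
HB.instance Definition _ := Choice.on signal.
HB.instance Definition _ := isPointed.Build signal (0 : int).
HB.instance Definition _ := @isMeasurable.Build default_measure_display
  signal discrete_measurable discrete_measurable0
  discrete_measurableC discrete_measurableU.

Section game.
Variables (R : realType) (K : nat).

Local Notation moves := ('I_K * {set 'I_K})%type.

(** [h_n = (m_0, a_0, y_0, ..., a_{n-1}, y_{n-1})], with the product
    sigma-algebra. *)
Definition history (n : nat) :=
  (pprobability (RK R K) R * n.-tuple (adv_action R K * signal)%type)%type.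

(** A map into the simplex P(A) is measurable iff all its coordinates are. *)
Record strategy (A : finType) := Strategy {
  strategy_val :> forall n, history n -> fdist R A;
  measurable_strategy : forall n (x : A),
    measurable_fun [set: history n]
      (fun h => fdist_val (strategy_val h) x) }.

Definition adv_strategy := strategy {set 'I_K}.
Definition fore_strategy := strategy 'I_K.

Definition hist0 (m0 : probability (RK R K) R) : history 0 :=
  (m0, [tuple]).

Definition hist_extend (n : nat) (h : history n)
    (a : fdist R {set 'I_K}) (y : signal) : history n.+1 :=
  (h.1, [tuple of rcons h.2 (a : adv_action R K, y)]).

(** The expert [i : 'I_K] is number [i.+1] in [[K]]. *)
Definition sig_of (i : 'I_K) (j : {set 'I_K}) : signal :=
  if i \in j then Posz i.+1 else - Posz i.+1.

Definition step (x : 'rV[R]_K) (w : moves) : 'rV[R]_K :=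
  x + indic_vec R w.2 - (w.1 \in w.2)%:R *: ones R K.

Section law.
Variables (al : adv_strategy) (be : fore_strategy).

(** Conditional probability, given [h_n = h], that the moves
    [(I_n, J_n), (I_{n+1}, J_{n+1}), ...] are those listed in [s]. *)
Fixpoint moves_prob (n : nat) (h : history n) (s : seq moves) : R :=
  if s is w :: s' then
    be n h w.1 * al n h w.2 *
    moves_prob (hist_extend h (al n h) (sig_of w.1 w.2)) s'
  else 1.

(** [E^{m_0,al,be}[max_i X_T^i]]: the moves do not depend on the unobserved
    state, so the law of [X_0] and of the [T] first moves is the product of
    [m_0] and of [moves_prob (hist0 m0)]. *)
Definition regret (T : nat) (m0 : probability (RK R K) R) : \bar R :=
  \int[m0]_x (\sum_(s : T.-tuple moves)
    moves_prob (hist0 m0) s * maxcoord (foldl step x s))%:E.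

End law.

Definition inf_regret (T : nat) (m0 : probability (RK R K) R)
    (al : adv_strategy) : \bar R :=
  ereal_inf (range (fun be : fore_strategy => regret al be T m0)).

Definition cst_in_history (p : nat -> fdist R {set 'I_K}) : adv_strategy :=
  @Strategy {set 'I_K} (fun n _ => p n)
    (fun n x => @measurable_cst _ _ (history n) R setT (p n x)).

Definition alpha_star (a : R -> fdist R {set 'I_K}) (T : nat) : adv_strategy :=
  cst_in_history (fun n => a (n%:R / T%:R)).

End game.

(** * Derivatives and the differential inequality *)

Section calculus.
Variables (R : realType) (K : nat).
Implicit Types (f : R -> 'rV[R]_K -> R) (t : R) (x : 'rV[R]_K).

(** Time derivative on [[0, 1[], one-sided at [t = 0]. *)
Definition Dt_quot f t x : R -> R := fun s => (s - t)^-1 * (f s x - f t x).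

Definition derivable_t f t x : Prop :=
  cvg (Dt_quot f t x s @[s --> within `[0, 1[ t^']).

Definition Dt f t x : R := lim (Dt_quot f t x s @[s --> within `[0, 1[ t^']).

Definition derivable_x (i : 'I_K) f t x : Prop :=
  derivable (f t) x (delta_mx ord0 i).

Definition Dx (i : 'I_K) f t x : R := 'D_(delta_mx ord0 i) (f t) x.

Definition hessian f t x : 'M[R]_K := \matrix_(i, j) Dx i (Dx j f) t x.

(** Euclidean norms; the choice of norm only affects the constant [C]. *)
Definition norm_Dxxx f t x : R :=
  Num.sqrt (\sum_i \sum_j \sum_k (Dx i (Dx j (Dx k f)) t x) ^+ 2).

Definition norm_Dtx f t x : R := Num.sqrt (\sum_i (Dx i (Dt f) t x) ^+ 2).

Definition continuous_on (I : set R) f : Prop :=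
  {within I `*` [set: 'rV[R]_K],
    continuous (fun p : R * 'rV[R]_K => f p.1 p.2)}.

(** [f] is continuous on [[0,1] x R^K] and of class C^{1,2} on
    [[0,1[ x R^K]. *)
Record classical_C12 f : Prop := ClassicalC12 {
  classical_cont : continuous_on `[0, 1] f;
  classical_dt : forall t x, 0 <= t < 1 -> derivable_t f t x;
  classical_dx : forall t x i, 0 <= t < 1 -> derivable_x i f t x;
  classical_dxx : forall t x i j, 0 <= t < 1 -> derivable_x i (Dx j f) t x;
  classical_Dt_cont : continuous_on `[0, 1[ (Dt f);
  classical_Dx_cont : forall i, continuous_on `[0, 1[ (Dx i f);
  classical_Dxx_cont : forall i j, continuous_on `[0, 1[ (Dx i (Dx j f)) }.

(** The higher derivatives entering the growth bounds exist on
    [[0,1[ x R^K]; their continuity is not required. *)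
Record has_higher_derivatives f : Prop := HasHigherDerivatives {
  higher_dtt : forall t x, 0 <= t < 1 -> derivable_t (Dt f) t x;
  higher_dtx : forall t x i, 0 <= t < 1 -> derivable_x i (Dt f) t x;
  higher_dxxx : forall t x i j k, 0 <= t < 1 ->
    derivable_x i (Dx j (Dx k f)) t x }.

(** [u^T *m u] is the rank-one matrix [u u^T] of the row vector [u]. *)
Definition cov_mx (a : fdist R {set 'I_K}) (i : 'I_K) : 'M[R]_K :=
  \sum_(j : {set 'I_K}) a j *:
    ((i \in j)%:R *: ((indic_vec R (~: j)%SET)^T *m indic_vec R (~: j)%SET)
     + (i \notin j)%:R *: ((indic_vec R j)^T *m indic_vec R j)).

Definition pde_subsolution (a : R -> fdist R {set 'I_K}) f : Prop :=
  forall t x, 0 <= t < 1 ->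
    0 <= Dt f t x
         + 2^-1 * inf (range (fun i => \tr (hessian f t x *m cov_mx (a t) i))).

End calculus.

(* Main.v *)
(** Let [D_ij = e_j - 1_{i in j} 1] be the displacement of the state when the
    forecaster plays [i] and the adversary [j].  If [j] is drawn from a balanced
    [a_t], then for every fixed [i] the mean of [D_ij] is zero and its second
    moment is the matrix of the differential inequality.  A Taylor expansion
    therefore shows that, with [h = 1/T], the sequence
    [phi (n h) (sqrt h X_n)] is a submartingale up to an error
    [O(sqrt h / (T - n - 1))] at round [n], whatever the forecaster does; the
    errors add up to [O(T^(-1/4))], using [1/m <= 4 (m^(1/4) - (m-1)^(1/4))].

    The derivative bounds degenerate at time 1, so the last round needs
    [phi t x <= max x + sqrt (K (1 - t))], uniformly in [x].  This follows from
    the same one-round inequality on a grid of [[t, 1]] whose mesh tends to 0: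
    there [phi (1 - h)] exceeds [max] by at most
    [h |Dt phi 0 z| + O(sqrt h)], which grows linearly in [z] and is thus
    absorbed by the quadratic function [sum_k (z_k - x_k)^2], whose mean grows
    by at most [K h] per round. *)

Require Import Defs.
From mathcomp Require Import all_boot all_order all_algebra.
From mathcomp Require Import all_classical all_reals all_analysis.
From mathcomp Require Import measurable_realfun.
From mathcomp Require Import ring lra.

Set Implicit Arguments.
Unset Strict Implicit.
Unset Printing Implicit Defensive.

Import Order.TTheory GRing.Theory Num.Theory.
Import numFieldNormedType.Exports.

Local Open Scope classical_set_scope.
Local Open Scope ring_scope.

(** * One-variable calculus: monotonicity and a second-order Taylor lower bound *)

Lemma derive_ge0_le (R : realType) (f df : R -> R) (p q : R) :
  p <= q -> (forall s, s \in `]p, q[%R -> is_derive s 1 f (df s)) ->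
  {within `[p, q], continuous f} ->
  (forall s, s \in `]p, q[%R -> 0 <= df s) -> f p <= f q.
Proof.
rewrite le_eqVlt => /orP[/eqP->//|pq] fd fc df0.
have [c cpq fE] := MVT pq fd fc.
by rewrite -subr_ge0 fE mulr_ge0 ?df0// subr_ge0 ltW.
Qed.

(** Subtracting a quadratic polynomial centred at [p] reduces a Taylor lower bound to a sign
    condition on a derivative. *)
Lemma is_derive_subquad (R : realType) (f : R -> R) (df a b p s : R) :
  is_derive s 1 f df ->
  is_derive s 1 (fun u => f u - a * (u - p) - b * ((u - p) * (u - p)))
    (df - a - 2 * b * (s - p)).
Proof.
move=> fd.
have -> : (fun u => f u - a * (u - p) - b * ((u - p) * (u - p))) =
    f - a *: (id - cst p) - b *: ((id - cst p) * (id - cst p)) by exact/funext.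
apply: is_derive_eq.
rewrite /GRing.scale/= (_ : (id - cst p) s = s - p)//; ring.
Qed.

Lemma continuous_subquad (R : realType) (A : set R) (f : R -> R) (a b p : R) :
  {within A, continuous f} ->
  {within A, continuous (fun u => f u - a * (u - p) - b * ((u - p) * (u - p)))}.
Proof.
move=> fc x.
have xc : (u - p) @[u --> (x : subspace A)] --> x - p.
  have xpc : continuous (fun u : R => u - p).
    by move=> u; apply: cvgB; [exact: cvg_id|exact: cvg_cst].
  exact: (continuous_subspaceT xpc).
apply: cvgB; first by apply: cvgB; [exact: fc|exact: cvgMr].
by apply: cvgMr; exact: cvgM.
Qed.

(** Monotonicity is used twice, first for [f1] minus its affine minorant, then for [f] minus the
    quadratic one. Derivatives are required only inside the interval, which allows one-sided
    derivatives at time 0. *)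
Lemma derive2_ge_taylor (R : realType) (f f1 f2 : R -> R) (p q c : R) :
  p <= q ->
  (forall s, s \in `]p, q[%R -> is_derive s 1 f (f1 s)) ->
  (forall s, s \in `]p, q[%R -> is_derive s 1 f1 (f2 s)) ->
  {within `[p, q], continuous f} -> {within `[p, q], continuous f1} ->
  (forall s, s \in `]p, q[%R -> c <= f2 s) ->
  f p + (q - p) * f1 p + c / 2 * (q - p) ^+ 2 <= f q.
Proof.
move=> pq fd f1d fc f1c f2c.
have f1ge s : s \in `]p, q[%R -> f1 p + c * (s - p) <= f1 s.
  rewrite in_itv/= => /andP[ps sq].
  pose g u := f1 u - c * (u - p) - 0 * ((u - p) * (u - p)).
  have gd u : u \in `]p, s[%R -> is_derive u 1 g (f2 u - c - 2 * 0 * (u - p)).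
    rewrite in_itv/= => /andP[pu us]; apply: is_derive_subquad; apply: f1d.
    by rewrite in_itv/= pu (lt_trans us).
  have gc : {within `[p, s], continuous g}.
    apply: continuous_subquad; apply: continuous_subspaceW f1c.
    by apply: subset_itvl; rewrite bnd_simp ltW.
  suff : g p <= g s by rewrite /g; lra.
  apply: (derive_ge0_le (ltW ps) gd gc) => u; rewrite in_itv/= => /andP[pu us].
  by rewrite mulr0 mul0r subr0 subr_ge0 f2c// in_itv/= pu (lt_trans us).
pose g u := f u - f1 p * (u - p) - c / 2 * ((u - p) * (u - p)).
have gd u : u \in `]p, q[%R ->
    is_derive u 1 g (f1 u - f1 p - 2 * (c / 2) * (u - p)).
  by move=> upq; apply: is_derive_subquad; exact: fd.
have gc : {within `[p, q], continuous g} by exact: continuous_subquad.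
suff : g p <= g q by rewrite /g expr2; lra.
apply: (derive_ge0_le pq gd gc) => u upq; have := f1ge _ upq; lra.
Qed.

(** * Functions of several variables known through their partial derivatives *)

Section partials.
Variables (R : realType) (K : nat).
Implicit Types (F : 'rV[R]_K -> R) (x y v : 'rV[R]_K).

Local Notation e_ i := (delta_mx ord0 i : 'rV[R]_K).

Lemma is_derive_line F x v (s : R) : derivable F (x + s *: v) v ->
  is_derive s (1 : R) (fun u : R => F (x + u *: v)) ('D_v F (x + s *: v)).
Proof.
move=> Fd.
have E : (fun h : R => h^-1 *: (((fun u : R => F (x + u *: v)) \o shift s)
     (h *: (1 : R)) - F (x + s *: v))) =
   (fun h : R => h^-1 *: ((F \o shift (x + s *: v)) (h *: v) - F (x + s *: v))).
  apply/funext => h /=; congr (_ *: (F _ - _)).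
  by rewrite -[h *: 1]/(h * 1) mulr1 scalerDl addrCA.
by apply: DeriveDef; [rewrite /derivable E|rewrite /derive E].
Qed.

Lemma partial_mvt F x i (d : R) : (forall y, derivable F y (e_ i)) ->
  exists2 u : R, 0 <= u <= 1 &
    F (x + d *: e_ i) - F x = d * 'D_(e_ i) F (x + (u * d) *: e_ i).
Proof.
move=> Fd.
have gd (s : R) : is_derive s 1 (fun s => F (x + s *: e_ i))
  ('D_(e_ i) F (x + s *: e_ i)) by exact: is_derive_line.
have gc A : {within A, continuous (fun s : R => F (x + s *: e_ i))}.
  apply: continuous_subspaceT => s; apply: differentiable_continuous.
  apply/derivable1_diffP; have := gd s; case=> + _; apply.
have [d0|d0] := leP 0 d.
  have [c] := MVT_segment d0 (fun s _ => gd s) (gc _).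
  rewrite in_itv/= scale0r addr0 subr0 => /andP[c0 cd] ->.
  have [dE|dn0] := eqVneq d 0.
    by exists 0; rewrite ?lexx ?ler01// dE mulr0 !mul0r.
  have dp : 0 < d by rewrite lt_neqAle eq_sym dn0.
  exists (c / d); last by rewrite mulfVK// mulrC.
  by rewrite divr_ge0//= ler_pdivrMr// mul1r.
have [c] := MVT_segment (ltW d0) (fun s _ => gd s) (gc _).
rewrite in_itv/= scale0r addr0 sub0r => /andP[dc c0] E.
exists (c / d); last first.
  rewrite mulfVK ?lt_eqF// mulrC.
  by rewrite -[LHS]opprB E mulrN opprK.
by rewrite -[c / d]mulrNN -invrN divr_ge0 ?oppr_ge0 ?(ltW d0)//=
  ler_pdivrMr ?oppr_gt0// mul1r lerN2.
Qed.

(** The coordinates are switched from [x] to [y] one at a time, and the one-variable mean value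
    theorem is applied to each switch. The intermediate points stay in the box spanned by [x] and
    [y]. *)
Lemma partials_mvt F x y : (forall i y, derivable F y (e_ i)) ->
  exists2 xi : 'I_K -> 'rV[R]_K,
    (forall i j, `|xi i ord0 j - x ord0 j| <= `|y ord0 j - x ord0 j|) &
    F y - F x = \sum_i (y ord0 i - x ord0 i) * 'D_(e_ i) F (xi i).
Proof.
move=> Fd.
pose z (k : nat) : 'rV[R]_K := \row_i (if (i < k)%N then y ord0 i else x ord0 i).
have z0 : z 0%N = x by apply/rowP => i; rewrite mxE.
have zK : z K = y by apply/rowP => i; rewrite mxE ltn_ord.
have zS (k : 'I_K) : z k.+1 = z k + (y ord0 k - x ord0 k) *: e_ k.
  apply/rowP => i; rewrite !mxE/= ltnS leq_eqVlt -(inj_eq val_inj)/=.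
  case: (ltngtP i k) => //= [| |/val_inj ->]; rewrite ?mulr0 ?addr0//.
  by rewrite mulr1 addrC subrK.
have H (k : 'I_K) := @partial_mvt F (z k) k (y ord0 k - x ord0 k) (Fd k).
pose u k := s2val (cid2 (H k)).
have u01 k : 0 <= u k <= 1 by rewrite /u; case: cid2.
have uE (k : 'I_K) : F (z k.+1) - F (z k) = (y ord0 k - x ord0 k) *
    'D_(e_ k) F (z k + (u k * (y ord0 k - x ord0 k)) *: e_ k).
  by rewrite /u; case: cid2 => ? ? ?; rewrite zS.
exists (fun k : 'I_K => z k + (u k * (y ord0 k - x ord0 k)) *: e_ k).
  move=> i j.
  have -> : (z i + (u i * (y ord0 i - x ord0 i)) *: e_ i) ord0 j =
      z i ord0 j + (u i * (y ord0 i - x ord0 i)) * (j == i)%:R.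
    by rewrite !mxE eqxx.
  have [->|ji] := eqVneq j i.
    rewrite mulr1 mxE ltnn addrAC subrr add0r normrM ler_piMl//.
    by rewrite ger0_norm//; case/andP: (u01 i).
  by rewrite mulr0 addr0 mxE; case: ifP; rewrite ?subrr ?normr0.
rewrite -[in LHS]zK -[in LHS]z0 -(telescope_sumr (fun k => F (z k)))//.
by rewrite big_mkord; apply: eq_bigr => k _; rewrite uE.
Qed.

Lemma partials_lipschitz F (M r : R) x y : (forall i y, derivable F y (e_ i)) ->
  (forall i y, `|'D_(e_ i) F y| <= M) ->
  (forall i, `|y ord0 i - x ord0 i| <= r) ->
  `|F y - F x| <= K%:R * r * M.
Proof.
move=> Fd FM xyr; have [xi _ ->] := partials_mvt x y Fd.
rewrite (le_trans (ler_norm_sum _ _ _))//.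
have -> : K%:R * r * M = \sum_(i < K) r * M.
  by rewrite sumr_const card_ord -mulrA mulr_natl.
by apply: ler_sum => i _; rewrite normrM ler_pM.
Qed.

(** As [h] tends to 0, the intermediate points of [partials_mvt] are squeezed to [x + s *: v], so
    continuity of the partial derivatives identifies the limit of the quotient. *)
Lemma partials_ray F x v (s : R) : (forall i y, derivable F y (e_ i)) ->
  (forall i, continuous ('D_(e_ i) F)) ->
  is_derive s (1 : R) (fun u : R => F (x + u *: v))
    (\sum_i v ord0 i * 'D_(e_ i) F (x + s *: v)).
Proof.
move=> Fd Fc.
have H : h^-1 *: (((fun u : R => F (x + u *: v)) \o shift s)
     (h *: (1 : R)) - F (x + s *: v)) @[h --> (0:R)^'] -->
    \sum_i v ord0 i * 'D_(e_ i) F (x + s *: v).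
  pose xi (h : R) := s2val (cid2 (partials_mvt (x + s *: v) (x + (h + s) *: v) Fd)).
  have xiP h i j : `|xi h i ord0 j - (x + s *: v) ord0 j| <= `|h * v ord0 j|.
    rewrite /xi; case: cid2 => /= ? /(_ i j)/le_trans + _; apply.
    rewrite !mxE le_eqVlt; apply/orP; left; apply/eqP; congr (`|_|); ring.
  have xiE h : F (x + (h + s) *: v) - F (x + s *: v) =
     \sum_i h * v ord0 i * 'D_(e_ i) F (xi h i).
    rewrite /xi; case: cid2 => /= ? _ ->.
    by apply: eq_bigr => i _; rewrite !mxE; congr (_ * _); ring.
  have xic i : xi h i @[h --> (0:R)^'] --> x + s *: v.
    apply/cvgrPdist_lt => e e0.
    (* The summand 1 keeps the divisor positive when [v = 0]. *)
    have vp : 0 < `|v| + 1 by rewrite ltr_pwDr.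
    near=> h.
    rewrite distrC [ltLHS]/Num.Def.normr/= mx_normrE.
    apply/bigmax_ltP; split => // -[a b] _ /=; rewrite {a}(ord1 a) !mxE.
    have := xiP h i b; rewrite !mxE => /le_lt_trans; apply.
    rewrite normrM (@le_lt_trans _ _ (`|h| * (`|v| + 1)))//.
      rewrite ler_wpM2l// (@le_trans _ _ `|v|) ?lerDl//.
      rewrite [leRHS]/Num.Def.normr/= mx_normrE.
      by apply: le_trans (le_bigmax _ _ (ord0, b)).
    rewrite -ltr_pdivlMr//; near: h.
    apply: dnbhs0_lt; exact: divr_gt0.
  have E : {near (0:R)^', (fun h => \sum_i v ord0 i * 'D_(e_ i) F (xi h i)) =1
    (fun h => h^-1 *: (((fun u : R => F (x + u *: v)) \o shift s)
     (h *: (1 : R)) - F (x + s *: v)))}.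
    near=> h.
    have h0 : h != 0 by near: h; exact: nbhs_dnbhs_neq.
    rewrite /= -[h *: 1]/(h * 1) mulr1 xiE -[RHS]/(h^-1 * _) mulr_sumr.
    by apply: eq_bigr => i _; rewrite -mulrA mulKf.
  apply: cvg_trans (near_eq_cvg E) _.
  apply: (@cvg_big R 'I_K +%R 0 xpredT) => [|i _].
    exact: add_continuous.
  apply: cvgMr.
  exact: continuous_cvg (Fc i _) (xic i).
apply: DeriveDef; first by apply/cvg_ex; eexists; exact: H.
exact: cvg_lim.
Unshelve. all: by end_near. Qed.
End partials.

(** * Taylor lower bound in space with a third-order remainder *)

Section taylor.
Variables (R : realType) (K : nat).
Implicit Types (F : 'rV[R]_K -> R) (x y v : 'rV[R]_K).

Local Notation e_ i := (delta_mx ord0 i : 'rV[R]_K).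

Lemma is_derive_within_continuous (g dg : R -> R) (A : set R) :
  (forall s : R, is_derive s 1 g (dg s)) -> {within A, continuous g}.
Proof.
move=> gd; apply: continuous_subspaceT => s; apply: differentiable_continuous.
by apply/derivable1_diffP; have := gd s; case=> + _; apply.
Qed.

(** The one-variable bound is applied to [F] along the segment from [x] to [x + v]. The second
    derivative there differs from its initial value by at most a Lipschitz constant of the second
    partials, given by the third ones. *)
Lemma partials_taylor F (M r : R) x v :
  (forall i y, derivable F y (e_ i)) ->
  (forall i j y, derivable ('D_(e_ j) F) y (e_ i)) ->
  (forall i j k y, derivable ('D_(e_ j) ('D_(e_ k) F)) y (e_ i)) ->
  (forall i, continuous ('D_(e_ i) F)) ->
  (forall i j, continuous ('D_(e_ i) ('D_(e_ j) F))) ->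
  (forall i j k y, `|'D_(e_ i) ('D_(e_ j) ('D_(e_ k) F)) y| <= M) ->
  (forall i, `|v ord0 i| <= r) ->
  F x + \sum_i v ord0 i * 'D_(e_ i) F x
    + 2^-1 * (\sum_i \sum_j v ord0 i * v ord0 j * 'D_(e_ i) ('D_(e_ j) F) x)
    - (K ^ 3)%:R * r ^+ 3 * M <= F (x + v).
Proof.
move=> F1 F2 F3 c1 c2 FM vr.
pose f (s : R) := F (x + s *: v).
pose f1 (s : R) := \sum_j v ord0 j * 'D_(e_ j) F (x + s *: v).
pose f2 (s : R) := \sum_j v ord0 j *
  (\sum_i v ord0 i * 'D_(e_ i) ('D_(e_ j) F) (x + s *: v)).
have fd (s : R) : is_derive s 1 f (f1 s) by exact: partials_ray.
have f1d (s : R) : is_derive s 1 f1 (f2 s).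
  have h j : is_derive s 1 (fun u => v ord0 j * 'D_(e_ j) F (x + u *: v))
      (v ord0 j * (\sum_i v ord0 i * 'D_(e_ i) ('D_(e_ j) F) (x + s *: v))).
    have := @partials_ray _ _ ('D_(e_ j) F) x v s (fun i => F2 i j) (fun i => c2 i j).
    by move=> ?; apply: is_deriveZ.
  have := is_derive_sum h.
  rewrite (_ : \sum_(i < K) _ = f1)//.
  by apply/funext => u; rewrite fct_sumE.
(* The double sum over coordinates contributes [K ^ 2 * r ^ 2], and [partials_lipschitz] for each
   second partial contributes [K * r * M]. *)
set L := (K ^ 3)%:R * r ^+ 3 * M.
have r0 (i : 'I_K) : 0 <= r by exact: le_trans (vr i).
have fL s : s \in `]0, 1[%R -> f2 0 - L <= f2 s.
  rewrite in_itv/= => /andP[s0 s1].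
  rewrite lerBlDr -lerBlDl.
  have -> : L = \sum_(j < K) \sum_(i < K) r * (r * (K%:R * r * M)).
    rewrite !sumr_const card_ord -mulrnA -mulr_natl /L.
    rewrite !expnS expn0 muln1 !natrM; ring.
  rewrite /f2 -sumrB; apply: ler_sum => j _.
  rewrite -mulrBr -sumrB mulr_sumr; apply: ler_sum => i _.
  rewrite -mulrBr; apply: le_trans (ler_norm _) _.
  rewrite !normrM ler_pM// ler_pM//.
  apply: (@partials_lipschitz R K ('D_(e_ i) ('D_(e_ j) F)) M r) => [k y|k y|k].
  - exact: F3.
  - exact: FM.
  rewrite scale0r addr0 !mxE opprD addrA subrr add0r normrN normrM.
  by rewrite (le_trans _ (vr k))// ler_piMl// ger0_norm ltW.
have := @derive2_ge_taylor _ f f1 f2 0 1 (f2 0 - L) ler01 (fun s _ => fd s)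
  (fun s _ => f1d s) (is_derive_within_continuous fd) (is_derive_within_continuous f1d) fL.
rewrite subr0 mul1r expr1n mulr1 /f /f1 scale0r addr0 scale1r.
apply: le_trans.
have -> : 2^-1 * (\sum_i \sum_j v ord0 i * v ord0 j *
  'D_(e_ i) ('D_(e_ j) F) x) = f2 0 / 2.
  rewrite mulrC /f2 scale0r addr0 exchange_big/=; congr (_ / _).
  apply: eq_bigr => j _; rewrite mulr_sumr; apply: eq_bigr => i _.
  by rewrite mulrA [v ord0 i * _]mulrC.
(* The expansion loses only [L / 2]; the sign of [L] allows the factor to be dropped. The signs of
   [r] and [M] come from a coordinate, so [K = 0] is treated apart. *)
have L0 : 0 <= L.
  rewrite /L; case: (posnP K) => [->|K0]; first by rewrite !mul0r.
  by rewrite !mulr_ge0// ?exprn_ge0 ?(r0 (Ordinal K0))// (le_trans _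
    (FM (Ordinal K0) (Ordinal K0) (Ordinal K0) 0)).
by rewrite mulrBl addrA lerD2l lerN2 ler_piMr// invf_le1 ?ler1n.
Qed.
End taylor.

(** * Continuity of slices and the time derivative at interior times *)

Section slices.
Variables (R : realType) (K : nat).
Implicit Types (f : R -> 'rV[R]_K -> R) (I : set R).

Lemma continuous_on_space I f (t : R) : continuous_on I f -> I t -> continuous (f t).
Proof.
move=> /subspace_continuousP fc It x.
have := fc (t, x) (conj It Logic.I) => /= H P /H.
rewrite /nbhs/= /within/= => -[[U V] /= [Ut Vx] UV].
rewrite /nbhs/=.
apply: filterS Vx => y Vy; apply: (UV (t, y)) => //=.
by split=> //; exact: nbhs_singleton.
Qed.

Lemma continuous_on_time I f x : continuous_on I f ->
  {within I, continuous (f ^~ x)}.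
Proof.
move=> /subspace_continuousP fc; apply/subspace_continuousP => t It.
have := fc (t, x) (conj It Logic.I) => /= H P /H.
rewrite /nbhs/= /within/= => -[[U V] /= [Ut Vx] UV].
rewrite /nbhs/=.
apply: filterS Ut => s Us Is; apply: (UV (s, x)) => //=.
by split=> //; exact: nbhs_singleton.
Qed.

(** [Dt] is a limit within [[0, 1[]; at an interior time all small increments stay in this interval,
    so it is the two-sided derivative. *)
Lemma is_derive_Dt f (t : R) x : 0 < t < 1 -> derivable_t f t x ->
  is_derive t (1 : R) (f ^~ x) (Dt f t x).
Proof.
move=> t01 fd.
have shf : (h + t) @[h --> (0:R)^'] --> within `[0, 1[ t^'.
  move=> P; rewrite /within/= => /nbhs_ballP[e /= e0 eP].
  have : \forall h \near (0:R)^', `|h| < e /\ h + t \in `]0, 1[%R.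
    near=> h; split; first by near: h; exact: dnbhs0_lt.
    near: h; apply: nbhs_dnbhs.
    have : (h + t) @[h --> (0:R)] --> 0 + t by apply: cvgD => //; exact: cvg_cst.
    rewrite add0r => /(_ `]0, 1[%classic); apply.
    by apply: (@near_in_itvoo R 0 1) ; rewrite in_itv.
  move=> nh; rewrite /nbhs/=.
  near=> h.
  have [he] : `|h| < e /\ h + t \in `]0, 1[%R by near: h.
  rewrite in_itv/= => /andP[h0 h1].
  have hn0 : h != 0 by near: h; exact: nbhs_dnbhs_neq.
  apply: (eP (h + t)) => /=.
  - by rewrite /ball/= opprD addrCA subrr addr0 normrN.
  - by rewrite -subr_eq0 addrK.
  - by rewrite in_itv/= ltW.
have H : h^-1 *: (((f ^~ x) \o shift t) (h *: (1 : R)) - f t x)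
    @[h --> (0:R)^'] --> Dt f t x.
  have := cvg_comp _ _ shf fd.
  rewrite (_ : Dt_quot f t x \o (fun h => h + t) =
    (fun h : R => h^-1 *: (((f ^~ x) \o shift t) (h *: (1 : R)) - f t x)))//.
  by apply/funext => h; rewrite /Dt_quot/= addrK -[h *: 1]/(h * 1) mulr1.
apply: DeriveDef; first by apply/cvg_ex; eexists; exact: H.
exact: cvg_lim.
Unshelve. all: by end_near. Qed.

End slices.

(** * First and second moments of the displacement of one round *)

Section displacement.
Variables (R : realType) (K : nat).

Definition displacement (i : 'I_K) (j : {set 'I_K}) : 'rV[R]_K :=
  indic_vec R j - (i \in j)%:R *: ones R K.

Lemma stepE (x : 'rV[R]_K) (w : 'I_K * {set 'I_K}) :
  step x w = x + displacement w.1 w.2.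
Proof. by rewrite /step /displacement addrA. Qed.

Lemma displacementE (i : 'I_K) (j : {set 'I_K}) k :
  displacement i j ord0 k = (k \in j)%:R - (i \in j)%:R.
Proof. by rewrite !mxE mulr1. Qed.

Lemma displacement_le1 i j k : `|displacement i j ord0 k| <= 1.
Proof.
rewrite displacementE; case: (_ \in _); case: (_ \in _) => /=;
  by rewrite ?subrr ?subr0 ?sub0r ?normrN ?normr0 ?normr1 ?ler01.
Qed.

(** The mean of coordinate [k] is the probability that [k] is in the drawn set minus the probability
    that [i] is; balance makes them equal. *)
Lemma displacement_mean0 (a : fdist R {set 'I_K}) i k : balanced a ->
  \sum_j a j * displacement i j ord0 k = 0.
Proof.
move=> ab; under eq_bigr do rewrite displacementE mulrBr !mulr_natr !mulrb.
by rewrite sumrB -!big_mkcond/= (ab i k) subrr.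
Qed.

(** The displacement is [e_j] if [i] is not in [j], and minus the indicator of the complement
    otherwise; the sign disappears in the outer product. *)
Lemma displacement_cov (a : fdist R {set 'I_K}) i (H : 'M[R]_K) :
  \tr (H *m cov_mx a i) = \sum_j a j *
    \sum_k \sum_l displacement i j ord0 k * displacement i j ord0 l * H k l.
Proof.
have covE k l : cov_mx a i l k =
    \sum_j a j * (displacement i j ord0 k * displacement i j ord0 l).
  rewrite /cov_mx summxE; apply: eq_bigr => j _.
  rewrite !mxE !big_ord1 !mxE !mulr1 !inE; congr (_ * _).
  by case: (i \in j); case: (k \in j); case: (l \in j) => /=; ring.
under [RHS]eq_bigr do rewrite mulr_sumr.
rewrite exchange_big/=; apply: eq_bigr => k _.
rewrite mxE; under [RHS]eq_bigr do rewrite mulr_sumr.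
rewrite exchange_big/=; apply: eq_bigr => l _.
rewrite covE mulr_sumr; apply: eq_bigr => j _; ring.
Qed.

End displacement.

(** * Size and summation of the one-round errors *)

Section errors.
Variable R : realType.
Implicit Types (h : R) (m : nat).

Definition root4 m : R := Num.sqrt (Num.sqrt m%:R).

Lemma root4_ge0 m : 0 <= root4 m.
Proof. exact: sqrtr_ge0. Qed.

Lemma root4X m : root4 m ^+ 4 = m%:R.
Proof.
by rewrite /root4 (exprM _ 2 2) !sqr_sqrtr ?sqrtr_ge0// ler0n.
Qed.

(* [(m+1)^(1/4) - m^(1/4) >= (m+1)^(-3/4) / 4], by factoring
   [1 = (m+1) - m] as a difference of fourth powers. *)
Lemma root4_incr m : (m.+1%:R)^-1 + 4 * root4 m <= 4 * root4 m.+1.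
Proof.
have s0 := root4_ge0 m; have t0 := root4_ge0 m.+1.
have sE := root4X m; have tE := root4X m.+1.
set s := root4 m in s0 sE *; set t := root4 m.+1 in t0 tE *.
have t4 : t ^+ 4 - s ^+ 4 = 1 by rewrite sE tE -natrB// subSnn.
have st : s <= t by rewrite /s /t !ler_wsqrtr// ler_nat.
have t1 : 1 <= t.
  by rewrite /t /root4 -[leLHS]sqrtr1 ler_wsqrtr// -[leLHS]sqrtr1 ler_wsqrtr// ler1n.
rewrite -tE -lerBrDr -mulrBr.
rewrite -[leLHS]mul1r ler_pdivrMr ?exprn_gt0 ?(lt_le_trans ltr01)//.
have ts0 : 0 <= t - s by rewrite subr_ge0.
rewrite -[leLHS]t4.
have -> : t ^+ 4 - s ^+ 4 = (t - s) * (t ^+ 3 + t ^+ 2 * s + t * s ^+ 2 + s ^+ 3).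
  by ring.
rewrite [leRHS](_ : _ = (t - s) * (4 * t ^+ 4)); last by ring.
rewrite ler_wpM2l//.
(* Each of the four terms of the cofactor is at most [t ^+ 3], hence at most [t ^+ 4] because
   [1 <= t]. *)
have h3 : t ^+ 3 <= t ^+ 4 by rewrite ler_weXn2l.
have h2 : t ^+ 2 * s <= t ^+ 3 by rewrite [t ^+ 3]exprSr ler_wpM2l ?exprn_ge0.
have h1 : t * s ^+ 2 <= t ^+ 3 by rewrite [t ^+ 3]exprS ler_wpM2l ?lerXn2r.
have h0 : s ^+ 3 <= t ^+ 3 by rewrite lerXn2r.
lra.
Qed.

(** Here [m.+2] steps of length [h] remain before the round and [m.+1] after it. The summands are
    the Taylor errors in space and in time; the latter is of order [h ^ 2 / (m.+1 * h) ^ (3/2)],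
    that is [sqrt h / m.+1 ^ (3/2)]. *)
Lemma one_round_error (c1 c2 : R) h m : 0 < h -> 0 <= c1 -> 0 <= c2 ->
  h * Num.sqrt h * c1 * (c2 / (m.+2%:R * h))
    + c2 / (m.+1%:R * h) `^ (3 / 2) / 2 * h ^+ 2
  <= (c1 + 1) * c2 * Num.sqrt h * (m.+1%:R)^-1.
Proof.
move=> h0 c10 c20.
set r := Num.sqrt h.
have r0 : 0 < r by rewrite sqrtr_gt0.
have rh : r * r = h by rewrite -expr2 sqr_sqrtr// ltW.
have rn0 : r != 0 by rewrite gt_eqF.
have m0 : 0 < m.+1%:R :> R by rewrite ltr0n.
have mh0 : 0 < m.+1%:R * h by rewrite mulr_gt0.
rewrite -[h in leLHS]rh.
have e1 : r * r * r * c1 * (c2 / (m.+2%:R * (r * r))) <= c1 * c2 * r / m.+1%:R.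
  have -> : r * r * r * c1 * (c2 / (m.+2%:R * (r * r))) = c1 * c2 * r / m.+2%:R.
    field; rewrite rn0/= andbT.
    by rewrite gt_eqF// ltr_wpDr.
  rewrite ler_wpM2l ?mulr_ge0 ?(ltW r0)// lef_pV2 ?posrE ?ltr0n//.
  by rewrite ler_nat.
have pE : (m.+1%:R * (r * r)) `^ (3 / 2) = m.+1%:R * r * r * (Num.sqrt m.+1%:R * r).
  rewrite rh (_ : 3 / 2 = 1 + 2^-1); last by field.
  rewrite powRD ?(gt_eqF mh0) ?implybT// powRr1 ?(ltW mh0)//.
  rewrite powR12_sqrt ?(ltW mh0)// sqrtrM// -/r -rh; ring.
have q1 : 1 <= Num.sqrt (m.+1%:R : R).
  by rewrite -[leLHS]sqrtr1 ler_wsqrtr// ler1n.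
have e2 : c2 / (m.+1%:R * (r * r)) `^ (3 / 2) / 2 * (r * r) ^+ 2 <= c2 * r / m.+1%:R.
  rewrite pE.
  have -> : c2 / (m.+1%:R * r * r * (Num.sqrt m.+1%:R * r)) / 2 * (r * r) ^+ 2
     = (c2 * r / m.+1%:R) * (Num.sqrt m.+1%:R * 2)^-1.
    by field; rewrite rn0/= nat1r pnatr_eq0/= gt_eqF// (lt_le_trans ltr01).
  rewrite ler_piMr// ?divr_ge0 ?mulr_ge0 ?(ltW r0) ?(ltW m0)//.
  rewrite invf_le1; lra.
rewrite -[X in _ <= X * _ * _ * _]/(c1 + 1).
have -> : (c1 + 1) * c2 * r / m.+1%:R = c1 * c2 * r / m.+1%:R + c2 * r / m.+1%:R by ring.
exact: lerD.
Qed.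

End errors.

(** * The maximal coordinate and the squared distance *)

Section maxcoord.
Variables (R : realType) (K : nat).
Implicit Types x y z : 'rV[R]_K.

Lemma le_maxcoord x i : x ord0 i <= maxcoord x.
Proof.
apply: ub_le_sup; last by exists i.
exists (\sum_k `|x ord0 k|) => _ [k _ <-].
by rewrite (le_trans (ler_norm _))// (bigD1 k)//= lerDl sumr_ge0.
Qed.

Lemma maxcoord_le x (u : R) : 'I_K -> (forall i, x ord0 i <= u) -> maxcoord x <= u.
Proof.
move=> i0 xu; apply: ge_sup; first by exists (x ord0 i0), i0.
by move=> _ [k _ <-].
Qed.

Lemma maxcoordD_le x y (u : R) : 'I_K -> (forall i, y ord0 i <= u) ->
  maxcoord (x + y) <= maxcoord x + u.
Proof.
by move=> i0 yu; apply: maxcoord_le => // i; rewrite mxE lerD ?le_maxcoord.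
Qed.

Lemma maxcoordD_ge x y (u : R) : 'I_K -> (forall i, - u <= y ord0 i) ->
  maxcoord x - u <= maxcoord (x + y).
Proof.
move=> i0 yu; rewrite lerBlDr; apply: maxcoord_le => // i.
rewrite -lerBlDr; apply: le_trans (le_maxcoord _ i).
by rewrite mxE lerD2l.
Qed.

Lemma maxcoordZ (l : R) x : 'I_K -> 0 < l -> maxcoord (l *: x) = l * maxcoord x.
Proof.
move=> i0 l0; apply/eqP; rewrite eq_le; apply/andP; split.
  by apply: maxcoord_le => // i; rewrite mxE ler_pM2l// le_maxcoord.
rewrite mulrC -ler_pdivlMr//; apply: maxcoord_le => // i.
by rewrite ler_pdivlMr// mulrC; apply: le_trans (le_maxcoord _ i); rewrite mxE.
Qed.

(** Jensen's inequality for the convex function [maxcoord] and a centred perturbation, read off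
    coordinate by coordinate. *)
Lemma maxcoord_mean_ge (A : finType) (p : fdist R A) (f : A -> 'rV[R]_K) x :
  'I_K -> (forall i, \sum_j p j * f j ord0 i = 0) ->
  maxcoord x <= \sum_j p j * maxcoord (x + f j).
Proof.
move=> i0 f0; apply: maxcoord_le => // i.
have -> : x ord0 i = \sum_j p j * (x ord0 i + f j ord0 i).
  under eq_bigr do rewrite mulrDr.
  by rewrite big_split/= f0 addr0 -mulr_suml fdist_sum1 mul1r.
apply: ler_sum => j _; rewrite ler_wpM2l ?fdist_ge0//.
by apply: le_trans (le_maxcoord _ i); rewrite mxE.
Qed.

Definition sqdist x z : R := \sum_k (z ord0 k - x ord0 k) ^+ 2.

Lemma sqdist_coord x z k : (z ord0 k - x ord0 k) ^+ 2 <= sqdist x z.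
Proof.
by rewrite /sqdist (bigD1 k)//= lerDl sumr_ge0// => ? _; exact: sqr_ge0.
Qed.

(** Young's inequality [d <= (d ^ 2 / s + s) / 2] for each coordinate of [z - x]. The scale [s] is
    left free, to be balanced against the growth of [sqdist]. *)
Lemma maxcoord_le_sqdist x z (s : R) : 'I_K -> 0 < s ->
  maxcoord z <= maxcoord x + (sqdist x z / s + s) / 2.
Proof.
move=> i0 s0; have -> : z = x + (z - x) by rewrite addrC subrK.
apply: maxcoordD_le => // i.
rewrite [x + _]addrC subrK !mxE.
have := sqdist_coord x z i; set d := z ord0 i - x ord0 i => dq.
have -> : (sqdist x z / s + s) / 2 = (sqdist x z + s ^+ 2) / (2 * s).
  by field; rewrite gt_eqF.
rewrite ler_pdivlMr ?mulr_gt0//.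
by have := sqr_ge0 (d - s); rewrite sqrrB; lra.
Qed.

(** The cross terms have zero mean by balance, and each of the [K] coordinates of the displacement
    is at most 1 in absolute value. *)
Lemma sqdist_mean_le (p : fdist R {set 'I_K}) i x z (r : R) : balanced p ->
  \sum_j p j * sqdist x (z + r *: displacement R i j) <= sqdist x z + K%:R * r ^+ 2.
Proof.
move=> pb.
have E j : p j * sqdist x (z + r *: displacement R i j) =
    p j * sqdist x z
    + \sum_k 2 * r * (z ord0 k - x ord0 k) * (p j * displacement R i j ord0 k)
    + p j * \sum_k r ^+ 2 * displacement R i j ord0 k ^+ 2.
  rewrite /sqdist !mulr_sumr -!big_split/=; apply: eq_bigr => k _.
  rewrite 2![in LHS]mxE; ring.
under eq_bigr do rewrite E.
rewrite !big_split/= -mulr_suml fdist_sum1 mul1r exchange_big/=.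
rewrite [X in _ + X + _]big1 ?addr0; last first.
  by move=> k _; rewrite -mulr_sumr displacement_mean0// mulr0.
rewrite lerD2l.
rewrite -[leRHS]mul1r -[X in _ <= X * _](fdist_sum1 p) mulr_suml; apply: ler_sum => j _.
rewrite ler_wpM2l ?fdist_ge0//.
have -> : K%:R * r ^+ 2 = \sum_(k < K) r ^+ 2 by rewrite sumr_const card_ord mulr_natl.
apply: ler_sum => k _; rewrite ler_piMr ?sqr_ge0//.
rewrite -real_normK ?num_real// expr_le1// displacement_le1//.
Qed.

End maxcoord.

(** * Primitives of the weights that are singular at time 1 *)

Lemma is_derive_sqrt1B (R : realType) (s : R) : s < 1 ->
  is_derive s (1 : R) (fun u : R => Num.sqrt (1 - u)) (- (2 * Num.sqrt (1 - s))^-1).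
Proof.
move=> s1.
have H1 : is_derive s (1 : R) (fun u : R => 1 - u) (-1).
  have -> : (fun u : R => 1 - u) = cst 1 - id by [].
  by apply: is_derive_eq; rewrite sub0r.
have H2 : is_derive (1 - s) (1 : R) Num.sqrt (2 * Num.sqrt (1 - s))^-1.
  by apply: is_derive1_sqrt; rewrite subr_gt0.
have := @is_derive1_comp R Num.sqrt (fun u : R => 1 - u) s _ _ H2 H1.
by rewrite mulrN1.
Qed.

Lemma is_derive_inv_sqrt1B (R : realType) (s : R) : s < 1 ->
  is_derive s (1 : R) (fun u : R => (Num.sqrt (1 - u))^-1)
    (2^-1 / (1 - s) `^ (3 / 2)).
Proof.
move=> s1.
have s0 : 0 < 1 - s by rewrite subr_gt0.
have q0 : 0 < Num.sqrt (1 - s) by rewrite sqrtr_gt0.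
have := is_derive_sqrt1B s1 => D.
have H := @is_deriveV R (fun u : R => Num.sqrt (1 - u)) s _ 1 (lt0r_neq0 q0) D.
apply: is_derive_eq.
rewrite -[LHS]/(- _ * _).
have -> : (1 - s) `^ (3 / 2) = Num.sqrt (1 - s) ^+ 3.
  rewrite (_ : 3 / 2 = 2^-1 * 3%:R); last by field.
  by rewrite powRrM powR12_sqrt ?(ltW s0)// powR_mulrn ?sqrtr_ge0.
field; exact: lt0r_neq0.
Qed.

(** * Expected outcome against an adversary who ignores the signals *)

Section game_value.
Variables (R : realType) (K : nat).
Local Notation moves := ('I_K * {set 'I_K})%type.

Lemma sum_cons_tuple (W : finType) (m : nat) (F : seq W -> R) :
  \sum_(s : m.+1.-tuple W) F s = \sum_(w : W) \sum_(s : m.-tuple W) F (w :: s).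
Proof.
rewrite pair_big/=.
rewrite (reindex (fun p : W * m.-tuple W => [tuple of p.1 :: p.2]))//=.
exists (fun s : m.+1.-tuple W => (thead s, [tuple of behead s])).
  by move=> [w s] _; congr (_, _); exact: val_inj.
by move=> s _; rewrite /= [RHS]tuple_eta; exact: val_inj.
Qed.

Variables (p : nat -> fdist R {set 'I_K}) (be : fore_strategy R K).

(** Conditional expectation of [F] at the state reached after [m] more rounds, given the history [h]
    and the present state [x]. *)
Definition game_value n (h : history R K n) m (F : 'rV[R]_K -> R) x : R :=
  \sum_(s : m.-tuple moves)
    moves_prob (cst_in_history p) be h s * F (foldl (@step R K) x s).

(* Since the adversary ignores the signals, the bound on one round is only
   needed for each deterministic choice [i] of the forecaster. *)
Lemma game_value_ge (T : nat) (Psi : nat -> 'rV[R]_K -> R) (F : 'rV[R]_K -> R) :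
  (forall x, Psi T x <= F x) ->
  (forall n i x, (n < T)%N ->
     Psi n x <= \sum_j p n j * Psi n.+1 (x + displacement R i j)) ->
  forall m n (h : history R K n) x, (n + m)%N = T -> Psi n x <= game_value h m F x.
Proof.
move=> PsiT Psistep; elim=> [|m IH] n h x nmT.
  rewrite /game_value (big_pred1 [tuple]); last by move=> s; apply/esym/eqP; exact: tuple0.
  by rewrite /= mul1r; rewrite addn0 in nmT; rewrite nmT.
rewrite /game_value (sum_cons_tuple m (fun s => moves_prob _ _ h s * F (foldl _ x s))).
have -> : \sum_(w : moves) \sum_(s : m.-tuple moves)
      moves_prob (cst_in_history p) be h (w :: s) * F (foldl (@step R K) x (w :: s)) =
    \sum_i \sum_j be n h i * (p n j *
      game_value (hist_extend h (p n) (sig_of i j)) m F (x + displacement R i j)).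
  rewrite [RHS]pair_big/=; apply: eq_bigr => -[i j] _ /=.
  rewrite /game_value !mulr_sumr; apply: eq_bigr => s _.
  by rewrite stepE !mulrA.
rewrite -[leLHS]mul1r -(fdist_sum1 (be n h)) mulr_suml; apply: ler_sum => i _.
rewrite -mulr_sumr ler_wpM2l ?fdist_ge0//.
have nT : (n < T)%N by rewrite -nmT addnS ltnS leq_addr.
apply: le_trans (Psistep n i x nT) _.
apply: ler_sum => j _; rewrite ler_wpM2l ?fdist_ge0// IH//.
by rewrite addSn -addnS.
Qed.

Lemma game_value_ge_maxcoord (T : nat) n (h : history R K n) x : 'I_K ->
  (forall n, (n < T)%N -> balanced (p n)) -> (n <= T)%N ->
  maxcoord x <= game_value h (T - n) (@maxcoord R K) x.
Proof.
move=> i0 pb nT; apply: (@game_value_ge T (fun=> @maxcoord R K)) => //.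
  move=> k i y kT; apply: maxcoord_mean_ge => // l.
  exact: displacement_mean0 (pb _ kT).
exact: subnKC.
Qed.

(** The lower bound by induction is applied to the opposite function: a round raises the maximum by
    at most 1. This upper bound serves integrability. *)
Lemma game_value_le_maxcoord (T : nat) (h : history R K 0) x : 'I_K ->
  game_value h T (@maxcoord R K) x <= maxcoord x + T%:R.
Proof.
move=> i0.
have := @game_value_ge T (fun n y => - (maxcoord y + (T%:R - n%:R)))
  (fun y => - maxcoord y) _ _ T 0%N h x (add0n _).
rewrite subr0 => H; rewrite -lerN2 (le_trans (H _ _))//.
- by move=> y; rewrite subrr addr0.
- move=> n i y nT; rewrite -[leLHS]mul1r -[X in X * _](fdist_sum1 (p n)) mulr_suml.
  apply: ler_sum => j _; rewrite ler_wpM2l ?fdist_ge0// lerN2.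
  have : maxcoord (y + displacement R i j) <= maxcoord y + 1.
    apply: maxcoordD_le => // k.
    by rewrite (le_trans (ler_norm _))// displacement_le1.
  rewrite -natr1; lra.
- by rewrite le_eqVlt -sumrN; apply/orP; left; apply/eqP; apply: eq_bigr => s _;
    rewrite mulrN.
Qed.

End game_value.

(** * Measurability, continuity and comparison of integrals on R^K *)

Section integration.
Variables (R : realType) (K : nat).

Lemma continuous_measurable_RK (f : 'rV[R]_K -> R) : continuous f ->
  measurable_fun [set: RK R K] (f : RK R K -> R).
Proof.
move=> /continuousP fc.
apply: (measurability _ (RGenOpens.measurableE R)) => _ [_ [b [c ->] <-]].
rewrite setTI; apply: sub_sigma_algebra; apply: fc; exact: interval_open.
Qed.

(** Positive and negative parts are compared separately, so the integral of [f] may be [-oo]; this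
    is how an initial integral of [phi] not known to be finite is handled. *)
Lemma le_integral_integrable (d : measure_display) (T : measurableType d)
  (mu : {measure set T -> \bar R}) (f g : T -> \bar R) :
  measurable_fun [set: T] f -> mu.-integrable [set: T] g ->
  (forall x, (f x <= g x)%E) -> (\int[mu]_x f x <= \int[mu]_x g x)%E.
Proof.
move=> mf ig fg; have mg := measurable_int _ ig.
rewrite [leLHS]integralE [leRHS]integralE; apply: leeB.
- apply: ge0_le_integral => //.
  + exact: measurable_funepos.
  + exact: measurable_funepos.
  + by move=> x _; apply: (@funepos_le _ _ setT) => [y _|]; [exact: fg|exact: in_setT].
- apply: ge0_le_integral => //.
  + exact: measurable_funeneg.
  + exact: measurable_funeneg.
  + by move=> x _; apply: (@funeneg_le _ _ setT) => [y _|]; [exact: fg|exact: in_setT].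
Qed.

Lemma continuous_maxcoord : 'I_K -> continuous (@maxcoord R K).
Proof.
move=> i0 x; have FF := nbhs_filter x.
apply/(@cvgrPdist_le _ _ _ (nbhs x)) => e e0.
near=> y.
have yx i : `|(y - x) ord0 i| <= e.
  apply: (@le_trans _ _ `|y - x|).
    rewrite [leRHS]/Num.Def.normr/= mx_normrE.
    exact: le_trans (le_bigmax _ _ (ord0, i)).
  by rewrite distrC; near: y; exact: (@cvgr_dist_le _ _ _ _ _ _ _ cvg_id).
have xyE : x + (y - x) = y by rewrite addrC subrK.
rewrite distrC ler_norml; apply/andP; split.
  rewrite lerBrDr addrC -[X in _ <= maxcoord X]xyE; apply: maxcoordD_ge => // i.
  by have /ler_normlP[] := yx i; rewrite lerNl.
rewrite lerBlDl addrC -[X in maxcoord X <= _]xyE addrC; apply: maxcoordD_le => // i.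
by have /ler_normlP[_] := yx i.
Unshelve. all: by end_near. Qed.

Lemma continuous_addr (v : 'rV[R]_K) : continuous (fun y : 'rV[R]_K => y + v).
Proof.
move=> y; have FF := nbhs_filter y.
apply: (@cvgD _ _ _ (nbhs y) FF (fun y => y) (fun=> v)); first exact: (@cvg_id _ (nbhs y)).
exact: (@cvg_cst _ v _ (nbhs y)).
Qed.

Lemma continuous_scaler (l : R) : continuous (fun y : 'rV[R]_K => l *: y).
Proof.
move=> y; have FF := nbhs_filter y.
exact: (@cvgZl_tmp R _ _ (nbhs y) FF l (fun y => y) y (@cvg_id _ (nbhs y))).
Qed.

End integration.

Lemma regretE (R : realType) (K : nat) (p : nat -> fdist R {set 'I_K})
    (be : fore_strategy R K) (T : nat) (m0 : probability (RK R K) R) :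
  regret (cst_in_history p) be T m0 =
  (\int[m0]_x (game_value p be (hist0 m0) T (@maxcoord R K) x)%:E)%E.
Proof. by []. Qed.

Lemma continuous_game_value (R : realType) (K : nat) (p : nat -> fdist R {set 'I_K})
    (be : fore_strategy R K) n (h : history R K n) m F :
  continuous F -> continuous (game_value p be h m F).
Proof.
move=> Fc x; rewrite /game_value.
have sc s : continuous (fun y : 'rV[R]_K => foldl (@step R K) y s).
  elim: s => [|w s IH] y /=; first exact: cvg_id.
  apply: (@cvg_comp _ _ _ (fun y => step y w)
    (fun y : 'rV[R]_K => foldl (@step R K) y s)); last exact: IH.
  have -> : (fun y => step y w) = (fun y => y + displacement R w.1 w.2).
    by apply/funext => z; rewrite stepE.
  by rewrite stepE; exact: continuous_addr.
have FF := nbhs_filter x.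
have Fs s : F (foldl (@step R K) y s) @[y --> nbhs x] --> F (foldl (@step R K) x s).
  exact: (@cvg_comp _ _ _ (fun y => foldl (@step R K) y s) F _ _ _ (sc s x) (Fc _)).
have ac : continuous (fun z : R * R => z.1 + z.2) by exact: add_continuous.
by apply: (@cvg_big R _ +%R 0 xpredT ac _ (nbhs x) _ _ _ FF) => s _; exact: cvgMr.
Qed.

(** * From pointwise bounds to the infimum of the regret *)

Section regret_bounds.
Variables (R : realType) (K : nat) (i0 : 'I_K) (m0 : probability (RK R K) R).
Hypothesis m0_integrable : m0.-integrable [set: RK R K]
     (fun x : RK R K => (maxcoord x)%:E).
Variables (p : nat -> fdist R {set 'I_K}) (T : nat).
Hypothesis p_balanced : forall n, (n < T)%N -> balanced (p n).

Lemma game_value_integrable (be : fore_strategy R K) :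
  m0.-integrable [set: RK R K]
    (fun x : RK R K => (game_value p be (hist0 m0) T (@maxcoord R K) x)%:E).
Proof.
have gm : measurable_fun [set: RK R K]
    (fun x : RK R K => (game_value p be (hist0 m0) T (@maxcoord R K) x)%:E).
  apply/measurable_EFinP; apply: continuous_measurable_RK.
  exact/continuous_game_value/continuous_maxcoord.
have b (x : RK R K) : maxcoord x <= game_value p be (hist0 m0) T (@maxcoord R K) x.
  by have := @game_value_ge_maxcoord R K p be T 0%N (hist0 m0) x i0 p_balanced isT;
    rewrite subn0.
have gi : m0.-integrable [set: RK R K]
    ((fun x : RK R K => `|(maxcoord x)%:E|) \+ cst T%:R%:E)%E.
  apply: integrableD => //; first exact: integrable_abse.
  exact: finite_measure_integrable_cst.
apply: (le_integrable measurableT gm _ gi) => x _ /=.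
rewrite lee_fin [leRHS]ger0_norm ?addr_ge0//.
have := b x; have := game_value_le_maxcoord p be T (hist0 m0) x i0.
have := ler_norm (maxcoord x); have := ler_norm (- maxcoord x); rewrite normrN.
have T0 : 0 <= T%:R :> R by [].
rewrite ler_norml; move=> ? ? ? ?; apply/andP; split; lra.
Qed.

(** The pointwise bound is uniform in the forecaster, so it survives integration against [m0] and
    then the infimum. The rest is care with infinite values. *)
Lemma integral_le_inf_regret (f : 'rV[R]_K -> R) (eps : R) :
  (0 < T)%N -> continuous f ->
  (forall (be : fore_strategy R K) x, f x <= (Num.sqrt T%:R)^-1 *
     game_value p be (hist0 m0) T (@maxcoord R K) x + eps) ->
  ((- eps)%:E <= ((Num.sqrt T%:R)^-1)%:E * inf_regret T m0 (cst_in_history p)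
     - \int[m0]_x (f x)%:E)%E.
Proof.
move=> T0 fc fG; set c := (Num.sqrt T%:R)^-1.
have c0 : 0 < c by rewrite invr_gt0 sqrtr_gt0 ltr0n.
set G := fun be (x : RK R K) => game_value p be (hist0 m0) T (@maxcoord R K) x in fG.
have Gfin be : (\int[m0]_x (G be x)%:E)%E \is a fin_num.
  exact: integrable_fin_num (game_value_integrable be).
have mf : measurable_fun [set: RK R K] (fun x : RK R K => (f x)%:E).
  by apply/measurable_EFinP; exact: continuous_measurable_RK.
have fle be : (\int[m0]_x (f x)%:E <= c%:E * \int[m0]_x (G be x)%:E + eps%:E)%E.
  have i1 : m0.-integrable [set: RK R K] (fun x => c%:E * (G be x)%:E)%E.
    by apply: integrableZl => //; exact: game_value_integrable.
  have i2 : m0.-integrable [set: RK R K] (cst eps%:E).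
    exact: finite_measure_integrable_cst.
  have -> : (c%:E * \int[m0]_x (G be x)%:E + eps%:E =
      \int[m0]_x (c%:E * (G be x)%:E + cst eps%:E x))%E.
    rewrite integralD//= integralZl//; last exact: game_value_integrable.
    by rewrite integral_cst//= probability_setT mule1.
  apply: le_integral_integrable => //; first exact: integrableD.
  by move=> x; rewrite /cst/= -EFinM -EFinD lee_fin; exact: fG.
(* One strategy with finite regret is enough to exclude [+oo] for the integral of [f]. *)
pose be0 : fore_strategy R K := @Strategy R K 'I_K (fun n _ => fdist_dirac R i0)
  (fun n x => @measurable_cst _ _ (history R K n) R setT (fdist_dirac R i0 x)).
have Mfin : (\int[m0]_x (maxcoord (x : 'rV[R]_K))%:E)%E \is a fin_num.
  exact: integrable_fin_num m0_integrable.
(* This keeps the infimum above [-oo], so that the difference is [+oo] when the integral of [f] is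
   [-oo]. *)
have infM : (\int[m0]_x (maxcoord (x : 'rV[R]_K))%:E <=
    inf_regret T m0 (cst_in_history p))%E.
  apply: le_ereal_inf_tmp => _ [be _ <-]; rewrite regretE.
  apply: le_integral_integrable.
  - exact: measurable_int m0_integrable.
  - exact: game_value_integrable.
  - move=> x; rewrite lee_fin.
    by have := @game_value_ge_maxcoord R K p be T 0%N (hist0 m0) x i0 p_balanced isT;
      rewrite subn0.
have infNy : (-oo < c%:E * inf_regret T m0 (cst_in_history p))%E.
  apply: (@lt_le_trans _ _ (c%:E * \int[m0]_x (maxcoord (x : 'rV[R]_K))%:E)%E).
    by rewrite -(fineK Mfin) -EFinM ltNyr.
  by rewrite lee_wpmul2l// lee_fin ltW.
have := fle be0; rewrite -(fineK (Gfin be0)) -EFinM -EFinD.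
move: fle; case: (\int[m0]_x (f x)%:E)%E => [r| |] fle //; last first.
  by move=> _; rewrite [(- -oo)%E]/= addey ?leey// gt_eqF.
move=> _; rewrite leeBrDr//.
have H : (((r - eps) / c)%:E <= inf_regret T m0 (cst_in_history p))%E.
  apply: le_ereal_inf_tmp => _ [be _ <-]; rewrite regretE.
  have := fle be; rewrite -/(G be) -(fineK (Gfin be)) -EFinM -EFinD !lee_fin.
  by rewrite ler_pdivrMr// lerBlDr mulrC.
apply: (@le_trans _ _ (c%:E * ((r - eps) / c)%:E)%E).
  by rewrite -EFinM -EFinD lee_fin mulrC divfK ?gt_eqF// addrC.
by rewrite lee_wpmul2l// lee_fin ltW.
Qed.

End regret_bounds.

Lemma limn_einf_ge0 (R : realType) (u : (\bar R)^nat) (D : R) : 0 <= D ->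
  (forall n, (0 < n)%N -> ((- (D / root4 R n))%:E <= u n)%E) -> (0 <= limn_einf u)%E.
Proof.
move=> D0 Du; rewrite limn_einf_lim; apply/lee_addgt0Pr => e e0.
rewrite -leeBlDr// add0e.
apply: lime_ge; first exact: is_cvg_einfs.
near=> n.
apply: le_ereal_inf_tmp => _ [k /= nk <-].
have n0 : (0 < n)%N by near: n; exact: nbhs_infty_gt.
have k0 : (0 < k)%N by exact: leq_trans nk.
apply: le_trans (Du k k0); rewrite lee_fin lerN2.
have r0 : 0 < root4 R k by rewrite !sqrtr_gt0 ltr0n.
rewrite ler_pdivrMr// mulrC -ler_pdivrMr//.
(* After taking fourth powers, it suffices that [n] exceeds the fourth power of [D / e]. *)
rewrite -(@ler_pXn2r _ 4) ?nnegrE ?root4_ge0 ?divr_ge0 ?(ltW e0)// root4X.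
apply: (@le_trans _ _ n%:R); last by rewrite ler_nat.
by near: n; exact: nbhs_infty_ger.
Unshelve. all: by end_near. Qed.

(** * Consequences of the differential inequality and of the derivative bounds *)

Section growth_bounds.
Variables (R : realType) (K : nat) (a : R -> fdist R {set 'I_K}).
Variables (phi : R -> 'rV[R]_K -> R) (C : R).
Hypothesis a_balanced : forall t : R, 0 <= t <= 1 -> balanced (a t).
Hypothesis phi_classical : classical_C12 phi.
Hypothesis phi_higher : has_higher_derivatives phi.
Hypothesis phi_pde : pde_subsolution a phi.
Hypothesis phi_terminal : forall x : 'rV[R]_K, phi 1 x <= maxcoord x.
Hypothesis hC : 0 < C.
Hypothesis phi_tt : forall (t : R) (x : 'rV[R]_K), 0 <= t < 1 ->
  `|Dt (Dt phi) t x| <= C / (1 - t) `^ (3 / 2).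
Hypothesis phi_xxx_tx : forall (t : R) (x : 'rV[R]_K), 0 <= t < 1 ->
  norm_Dxxx phi t x + norm_Dtx phi t x <= C / (1 - t).

Lemma Dxxx_le i j k (t : R) x : 0 <= t < 1 ->
  `|Dx i (Dx j (Dx k phi)) t x| <= C / (1 - t).
Proof.
move=> t01; apply: le_trans (phi_xxx_tx x t01).
apply: (@le_trans _ _ (norm_Dxxx phi t x)); last by rewrite lerDl sqrtr_ge0.
rewrite -sqrtr_sqr ler_wsqrtr//.
have le_sum (F : 'I_K -> R) k0 : (forall k, 0 <= F k) -> F k0 <= \sum_k F k.
  by move=> F0; rewrite (bigD1 k0)//= lerDl sumr_ge0.
apply: (le_trans (le_sum (fun k => Dx i (Dx j (Dx k phi)) t x ^+ 2) k _)).
  by move=> ?; exact: sqr_ge0.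
apply: (le_trans (le_sum (fun j => \sum_k Dx i (Dx j (Dx k phi)) t x ^+ 2) j _)).
  by move=> ?; apply: sumr_ge0 => ? _; exact: sqr_ge0.
apply: (le_sum (fun i => \sum_j \sum_k Dx i (Dx j (Dx k phi)) t x ^+ 2) i).
by move=> ?; do 2!apply: sumr_ge0 => ? _; exact: sqr_ge0.
Qed.

Lemma Dtx_le i (t : R) x : 0 <= t < 1 -> `|Dx i (Dt phi) t x| <= C / (1 - t).
Proof.
move=> t01; apply: le_trans (phi_xxx_tx x t01).
apply: (@le_trans _ _ (norm_Dtx phi t x)); last by rewrite lerDr sqrtr_ge0.
rewrite -sqrtr_sqr ler_wsqrtr// (bigD1 i)//=.
by rewrite lerDl sumr_ge0// => ? _; rewrite sqr_ge0.
Qed.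

Lemma time_taylor (t h : R) z : 0 <= t -> 0 < h -> t + h < 1 ->
  phi t z + h * Dt phi t z - C / (1 - (t + h)) `^ (3 / 2) / 2 * h ^+ 2
    <= phi (t + h) z.
Proof.
move=> t0 h0 th1.
have sub01 : `[t, t + h] `<=` `[0, 1[.
  move=> s; rewrite /= !in_itv/= => /andP[ts sh].
  by rewrite (le_trans t0)//= (le_lt_trans sh).
have oo s : s \in `]t, t + h[%R -> 0 < s < 1 /\ s < t + h.
  rewrite in_itv/= => /andP[ts sh].
  by rewrite (le_lt_trans t0)//= (lt_trans sh).
have tht : t <= t + h by rewrite lerDl ltW.
have := @derive2_ge_taylor R (phi ^~ z) (Dt phi ^~ z) (Dt (Dt phi) ^~ z) t (t + h)
  (- (C / (1 - (t + h)) `^ (3 / 2))) tht.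
rewrite [t + h - t]addrAC subrr add0r [in X in _ + X <= _]mulNr mulNr; apply.
- move=> s /oo[s01 _]; apply: is_derive_Dt => //.
  by apply: (classical_dt phi_classical); case/andP: s01 => /ltW-> ->.
- move=> s /oo[s01 _]; apply: is_derive_Dt => //.
  by apply: (higher_dtt phi_higher); case/andP: s01 => /ltW-> ->.
- apply: continuous_subspaceW (continuous_on_time (classical_cont phi_classical)).
  apply: (subset_trans sub01); apply: subset_itvl; by rewrite bnd_simp.
- exact: continuous_subspaceW (continuous_on_time (classical_Dt_cont phi_classical)).
- move=> s /oo[/andP[s0 s1] sth].
  rewrite lerNl (le_trans (ler_norm _))// normrN.
  rewrite (le_trans (phi_tt z _)) ?(ltW s0)//.
  (* The bound on the second time derivative increases with time, so its value at [t + h] serves on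
     the whole interval. *)
  rewrite ler_pM2l// lef_pV2 ?posrE ?powR_gt0 ?subr_gt0//.
  by rewrite ge0_ler_powR ?divr_ge0 ?nnegrE ?subr_ge0 ?(ltW th1)
    ?(ltW s1) ?lerB ?(ltW sth).
Qed.

Lemma space_taylor (t r : R) (x v : 'rV[R]_K) :
  0 <= t < 1 -> (forall i, `|v ord0 i| <= r) ->
  phi t x + \sum_i v ord0 i * Dx i phi t x
    + 2^-1 * (\sum_i \sum_j v ord0 i * v ord0 j * hessian phi t x i j)
    - (K ^ 3)%:R * r ^+ 3 * (C / (1 - t)) <= phi t (x + v).
Proof.
move=> t01 vr.
under [X in 2^-1 * X]eq_bigr do under eq_bigr do rewrite mxE.
have It : `[0, 1[%classic t by rewrite /= in_itv.
apply: partials_taylor => //.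
- by move=> i y; exact: (classical_dx phi_classical).
- by move=> i j y; exact: (classical_dxx phi_classical).
- by move=> i j k y; exact: (higher_dxxx phi_higher).
- by move=> i; exact: (@continuous_on_space R K _ (Dx i phi) t
    (@classical_Dx_cont R K phi phi_classical i) It).
- by move=> i j; exact: (@continuous_on_space R K _ (Dx i (Dx j phi)) t
    (@classical_Dxx_cont R K phi phi_classical i j) It).
- by move=> i j k y; exact: Dxxx_le.
Qed.

Lemma Dt_lipschitz (t r : R) (x v : 'rV[R]_K) :
  0 <= t < 1 -> (forall i, `|v ord0 i| <= r) ->
  `|Dt phi t (x + v) - Dt phi t x| <= K%:R * r * (C / (1 - t)).
Proof.
move=> t01 vr; apply: partials_lipschitz.
- by move=> i y; exact: (higher_dtx phi_higher).
- by move=> i y; exact: Dtx_le.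
- by move=> i; rewrite mxE addrAC subrr add0r.
Qed.

(* Along one round the drift of [phi] vanishes by balance, and its second
   order term is controlled from below by the differential inequality. *)
Lemma one_round_ge (t h : R) i x : 0 <= t -> 0 < h -> t + h < 1 ->
  phi t x - (h * Num.sqrt h * ((K ^ 3)%:R + K%:R) * (C / (1 - t))
             + C / (1 - (t + h)) `^ (3 / 2) / 2 * h ^+ 2) <=
  \sum_j a t j * phi (t + h) (x + Num.sqrt h *: displacement R i j).
Proof.
move=> t0 h0 th1; set r := Num.sqrt h.
have r0 : 0 <= r by exact: sqrtr_ge0.
have rh : r * r = h by rewrite -expr2 sqr_sqrtr// ltW.
have t1 : t < 1 by rewrite (le_lt_trans _ th1)// lerDl ltW.
have t01 : 0 <= t < 1 by rewrite t0.
set E := (X in phi t x - X).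
set d := displacement R i.
pose G j := \sum_k d j ord0 k * Dx k phi t x.
pose Q j := \sum_k \sum_l d j ord0 k * d j ord0 l * hessian phi t x k l.
have dr j k : `|(r *: d j) ord0 k| <= r.
  by rewrite mxE normrM (ger0_norm r0) ler_piMr// displacement_le1.
(* The expansion goes first in space at time [t], then in time at the displaced point.
   [Dt_lipschitz] brings [Dt phi] back to [x], which accounts for the summand [K%:R] next to [K ^ 3]
   in the error. *)
have step1 j : phi t x + r * G j + h / 2 * Q j + h * Dt phi t x - E
    <= phi (t + h) (x + r *: d j).
  have tt := time_taylor (x + r *: d j) t0 h0 th1.
  have st := space_taylor x t01 (dr j).
  have /ler_normlP[+ _] := Dt_lipschitz x t01 (dr j).
  rewrite opprB => dl.
  have GE : \sum_k (r *: d j) ord0 k * Dx k phi t x = r * G j.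
    by rewrite mulr_sumr; apply: eq_bigr => k _; rewrite mxE mulrA.
  have QE : \sum_k \sum_l (r *: d j) ord0 k * (r *: d j) ord0 l * hessian phi t x k l =
      h * Q j.
    rewrite mulr_sumr; apply: eq_bigr => k _; rewrite mulr_sumr.
    by apply: eq_bigr => l _; rewrite !mxE -rh; ring.
  rewrite GE QE in st.
  have hdl := ler_wpM2l (ltW h0) dl.
  have r3 : r ^+ 3 = h * r by rewrite exprS expr2 rh mulrC.
  rewrite r3 in st; rewrite /E -/r.
  lra.
have a0 j : 0 <= a t j by exact: fdist_ge0.
apply: (@le_trans _ _ (\sum_j a t j *
    (phi t x + r * G j + h / 2 * Q j + h * Dt phi t x - E))); last first.
  by apply: ler_sum => j _; rewrite ler_wpM2l.
have -> : \sum_j a t j * (phi t x + r * G j + h / 2 * Q j + h * Dt phi t x - E) =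
    (phi t x + h * Dt phi t x - E) * \sum_j a t j
    + r * (\sum_j a t j * G j) + h / 2 * \sum_j a t j * Q j.
  rewrite !mulr_sumr -!big_split/=; apply: eq_bigr => j _; ring.
have -> : \sum_j a t j * G j = 0.
  under eq_bigr do rewrite mulr_sumr.
  rewrite exchange_big/= big1// => k _.
  under eq_bigr do rewrite mulrA.
  by rewrite -mulr_suml displacement_mean0 ?mul0r//; apply: a_balanced; rewrite t0 ltW.
rewrite fdist_sum1 -displacement_cov.
have := phi_pde x t01.
move=> pde.
have Sle : inf (range (fun k => \tr (hessian phi t x *m cov_mx (a t) k))) <=
    \tr (hessian phi t x *m cov_mx (a t) i).
  apply: ge_inf; last by exists i.
  exists (- \sum_i0 `|\tr (hessian phi t x *m cov_mx (a t) i0)|) => _ [k _ <-].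
  rewrite lerNl (le_trans (ler_norm _))// normrN (bigD1 k)//= lerDl.
  by rewrite sumr_ge0.
have := ler_wpM2l (ltW h0) pde; rewrite mulr0.
have := ler_wpM2l (ltW h0) Sle.
lra.
Qed.

(** * Uniform time grids and the behaviour of [phi] near time 1 *)

Definition round_cst : R := ((K ^ 3)%:R + K%:R + 1) * C.

Lemma round_cst_ge0 : 0 <= round_cst.
Proof. by rewrite mulr_ge0 ?addr_ge0// ltW. Qed.

(** At least two steps must remain before the round, so that [t + h] stays below 1, where the
    derivative bounds blow up. *)
Lemma one_round_grid (t h : R) (m : nat) i x : 0 <= t -> 0 < h ->
  1 - t = m.+2%:R * h ->
  phi t x - round_cst * Num.sqrt h / m.+1%:R <=
  \sum_j a t j * phi (t + h) (x + Num.sqrt h *: displacement R i j).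
Proof.
move=> t0 h0 tE.
have thE : 1 - (t + h) = m.+1%:R * h.
  by rewrite opprD addrA tE -[m.+2]addn1 natrD mulrDl mul1r addrK.
have th1 : t + h < 1 by rewrite -subr_gt0 thE mulr_gt0// ltr0n.
apply: le_trans (one_round_ge i x t0 h0 th1).
rewrite tE thE lerD2l lerN2.
by apply: one_round_error => //; exact: ltW.
Qed.

(** The bound on the second time derivative is integrated from time 0: [C / (1 - r) ^ (3/2)] has
    primitive [2 * C / sqrt (1 - r)], so the sum [v] is nondecreasing. *)
Lemma Dt_ge (s : R) z : 0 <= s < 1 ->
  - `|Dt phi 0 z| - 2 * C / Num.sqrt (1 - s) <= Dt phi s z.
Proof.
move=> /andP[s0 s1].
pose v (r : R) := Dt phi r z + (2 * C) * (Num.sqrt (1 - r))^-1.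
have ivd (r : R) : r < 1 ->
    is_derive r (1 : R) (fun r => (2 * C) * (Num.sqrt (1 - r))^-1) (C / (1 - r) `^ (3 / 2)).
  move=> r1; have D := is_derive_inv_sqrt1B r1.
  have H := is_deriveZ (2 * C) D.
  apply: is_derive_eq; rewrite -[LHS]/(_ * _); field.
  by rewrite gt_eqF// powR_gt0// subr_gt0.
have vd (r : R) : r \in `]0, s[%R ->
    is_derive r (1 : R) v (Dt (Dt phi) r z + C / (1 - r) `^ (3 / 2)).
  rewrite in_itv/= => /andP[r0 rs].
  have r1 := lt_trans rs s1.
  apply: is_deriveD; last exact: ivd.
  apply: is_derive_Dt; first by rewrite r0.
  by apply: (higher_dtt phi_higher); rewrite (ltW r0).
have vc : {within `[0, s], continuous v}.
  have c1 : {within `[0, s], continuous (Dt phi ^~ z)}.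
    apply: continuous_subspaceW (continuous_on_time (classical_Dt_cont phi_classical)).
    by apply: subset_itvl; rewrite bnd_simp.
  have c2 : {within `[0, s], continuous (fun r => (2 * C) * (Num.sqrt (1 - r))^-1)}.
    apply: continuous_in_subspaceT => r; rewrite inE/= in_itv/= => /andP[_ rs].
    apply: differentiable_continuous; apply/derivable1_diffP.
    by have := ivd r (le_lt_trans rs s1); case=> + _; apply.
  by move=> r; apply: cvgD; [exact: c1|exact: c2].
have := derive_ge0_le s0 vd vc.
have v'0 r : r \in `]0, s[%R -> 0 <= Dt (Dt phi) r z + C / (1 - r) `^ (3 / 2).
  rewrite in_itv/= => /andP[r0 rs].
  have /(phi_tt z)/ler_normlP[+ _] : 0 <= r < 1 by rewrite (ltW r0) (lt_trans rs).
  by rewrite lerNl -subr_ge0 opprK.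
move=> /(_ v'0); rewrite /v subr0 sqrtr1 invr1 mulr1.
have := ler_norm (- Dt phi 0 z); rewrite normrN; have := hC; lra.
Qed.

(** [Dt_ge] is integrated once more, over [[1 - h, 1]]. The singularity is integrable and yields
    [4 * C * sqrt h]; continuity of [phi] reaches time 1. *)
Lemma terminal_layer (h : R) z : 0 < h <= 1 ->
  phi (1 - h) z <= phi 1 z + h * `|Dt phi 0 z| + 4 * C * Num.sqrt h.
Proof.
move=> /andP[h0 h1].
pose b := `|Dt phi 0 z|.
pose v (r : R) := phi r z + b * r - (4 * C) * Num.sqrt (1 - r).
have vd (r : R) : r \in `](1 - h), 1[%R ->
    is_derive r (1 : R) v (Dt phi r z + b + 2 * C / Num.sqrt (1 - r)).
  rewrite in_itv/= => /andP[hr r1].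
  have r0 : 0 < r by rewrite (le_lt_trans _ hr)// subr_ge0.
  have D1 : is_derive r (1 : R) (phi ^~ z) (Dt phi r z).
    apply: is_derive_Dt; first by rewrite r0.
    by apply: (classical_dt phi_classical); rewrite (ltW r0).
  have D2 := is_derive_sqrt1B r1.
  have D := is_deriveB (is_deriveD D1 (is_deriveZ b (is_derive_id r (1 : R))))
    (is_deriveZ (4 * C) D2).
  rewrite (_ : _ + 2 * C / _ = Dt phi r z + b *: (1 : R)
    - (4 * C) *: (- (2 * Num.sqrt (1 - r))^-1)); first exact: D.
  rewrite -[b *: 1]/(b * 1) mulr1; congr (_ + _).
  rewrite -[_ *: _]/(_ * _).
  have q0 : Num.sqrt (1 - r) != 0 by rewrite gt_eqF// sqrtr_gt0 subr_gt0.
  by field.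
have vc : {within `[1 - h, 1], continuous v}.
  have c1 : {within `[1 - h, 1], continuous (phi ^~ z)}.
    apply: continuous_subspaceW (continuous_on_time (classical_cont phi_classical)).
    by apply: subset_itvr; rewrite bnd_simp subr_ge0.
  have c2 : continuous (fun r : R => b * r).
    by move=> r; apply: cvgMr; exact: cvg_id.
  have c3 : continuous (fun r : R => (4 * C) * Num.sqrt (1 - r)).
    move=> r; apply: cvgMr; apply: continuous_cvg; first exact: sqrt_continuous.
    by apply: cvgB; [exact: cvg_cst|exact: cvg_id].
  move=> r; apply: cvgB; first apply: cvgD; first exact: c1.
  - exact: (continuous_subspaceT c2).
  - exact: (continuous_subspaceT c3).
have hh : 1 - h <= 1 by rewrite lerBlDr lerDl ltW.
have := derive_ge0_le hh vd vc.
have v'0 r : r \in `](1 - h), 1[%R -> 0 <= Dt phi r z + b + 2 * C / Num.sqrt (1 - r).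
  rewrite in_itv/= => /andP[hr r1].
  have /(Dt_ge z) : 0 <= r < 1.
    by rewrite r1 (le_trans _ (ltW hr))// subr_ge0.
  rewrite /b; lra.
move=> /(_ v'0); rewrite /v subrr sqrtr0 (_ : 1 - (1 - h) = h); last by ring.
rewrite -/b; lra.
Qed.

(** Backward induction from [1 - h], with [m] rounds to play before that time: each adds at most
    [K * h] to the mean of [sqdist], and its error is paid by an increment of [4 * root4]. *)
Lemma phi_le_quadratic (h al be : R) x (i : 'I_K) m (t : R) z : 0 < h -> 0 <= be ->
  (forall z, phi (1 - h) z <= al + be * sqdist x z) ->
  0 <= t -> 1 - t = m.+1%:R * h ->
  phi t z <= al + be * (sqdist x z + m%:R * h * K%:R)
             + round_cst * Num.sqrt h * (4 * root4 R m).
Proof.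
move=> h0 be0 base; elim: m t z => [|m IH] t z t0 tE.
  have -> : t = 1 - h by rewrite -[RHS]/(1 - h) -[h]mul1r -tE opprB addrC subrK.
  rewrite mul0r mul0r addr0 (le_trans (base z))// lerDl.
  apply: mulr_ge0; last exact/mulr_ge0/root4_ge0.
  by rewrite mulr_ge0 ?round_cst_ge0 ?sqrtr_ge0.
have thE : 1 - (t + h) = m.+1%:R * h.
  by rewrite opprD addrA tE -[m.+2]addn1 natrD mulrDl mul1r addrK.
have th0 : 0 <= t + h by rewrite addr_ge0// ltW.
have t1 : t <= 1 by rewrite -subr_ge0 tE mulr_ge0// ltW.
have := one_round_grid i z t0 h0 tE.
set c := round_cst * Num.sqrt h; set r := Num.sqrt h => H1.
set S := \sum_j _ in H1.
have H2 : S <=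
    al + be * (sqdist x z + K%:R * r ^+ 2 + m%:R * h * K%:R) + c * (4 * root4 R m).
  apply: (@le_trans _ _ (\sum_j a t j *
      (al + be * (sqdist x (z + r *: displacement R i j) + m%:R * h * K%:R)
        + c * (4 * root4 R m)))).
    by apply: ler_sum => j _; rewrite ler_wpM2l ?fdist_ge0// IH.
  have -> : \sum_j a t j *
      (al + be * (sqdist x (z + r *: displacement R i j) + m%:R * h * K%:R)
        + c * (4 * root4 R m)) =
     (al + be * (m%:R * h * K%:R) + c * (4 * root4 R m)) * \sum_j a t j +
     be * \sum_j a t j * sqdist x (z + r *: displacement R i j).
    rewrite !mulr_sumr -!big_split/=; apply: eq_bigr => j _; ring.
  rewrite fdist_sum1.
  have at_b : balanced (a t) by apply: a_balanced; rewrite t0.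
  have := ler_wpM2l be0 (sqdist_mean_le i x z r at_b); lra.
have c0 : 0 <= c by rewrite mulr_ge0 ?round_cst_ge0 ?sqrtr_ge0.
have := ler_wpM2l c0 (root4_incr R m).
have rr : r ^+ 2 = h by rewrite sqr_sqrtr// ltW.
have mS : m.+1%:R * h * K%:R = m%:R * h * K%:R + K%:R * h.
  by rewrite -natr1; ring.
rewrite mS; move: H1 H2; rewrite rr.
move: (m.+1%:R^-1) (root4 R m.+1) (root4 R m) (m%:R * h * K%:R) (phi t z).
by move=> w r1 r0 mhK ph; clear; lra.
Qed.

Lemma phi_le_maxcoord (t : R) x : 'I_K -> 0 <= t < 1 ->
  phi t x <= maxcoord x + Num.sqrt (K%:R * (1 - t)).
Proof.
move=> i0 /andP[t0 t1].
have ta0 : 0 < 1 - t by rewrite subr_gt0.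
have ta1 : 1 - t <= 1 by rewrite lerBlDr lerDl.
have K0 : 0 < K%:R :> R by rewrite ltr0n (leq_trans _ (ltn_ord i0)).
set ta := 1 - t in ta0 ta1 *.
set s := Num.sqrt (K%:R * ta).
have s0 : 0 < s by rewrite sqrtr_gt0 mulr_gt0.
have ss : s * s = K%:R * ta by rewrite -expr2 sqr_sqrtr// ltW// mulr_gt0.
pose A := `|Dt phi 0 x|.
(* The summands are, in order, the coefficients of the errors bounded below by [G4], [G5], [G6],
   [G2] and [G3]. *)
pose D := A + K%:R * C + 4 * C + K%:R * C * K%:R + 4 * round_cst.
have D0 : 0 <= D.
  by rewrite !addr_ge0 ?mulr_ge0 ?normr_ge0 ?round_cst_ge0 ?ltW.
have main n : phi t x <= maxcoord x + s + D / n.+1%:R.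
  (* With a fourth power of steps, [sqrt h] is at most [n.+1 ^ (-2)] and [root4] at most [n.+1], so
     the accumulated error is of order [1 / n.+1]. *)
  pose N := (n.+1 ^ 4)%N.
  have N0 : (0 < N)%N by rewrite expn_gt0.
  have n0 : 0 < n.+1%:R :> R by rewrite ltr0n.
  pose h := ta / N%:R.
  have NE : N%:R = n.+1%:R ^+ 4 :> R by rewrite natrX.
  have h0 : 0 < h by rewrite divr_gt0// ltr0n.
  have ninv : (n.+1%:R)^-1 <= 1 :> R by rewrite invf_le1// ler1n.
  have ninv0 : 0 <= (n.+1%:R)^-1 :> R by rewrite invr_ge0 ltW.
  have hn : h <= (n.+1%:R)^-1 ^+ 4.
    by rewrite /h NE exprVn ler_piMl// invr_ge0 exprn_ge0// ltW.
  have rn : Num.sqrt h <= (n.+1%:R)^-1 ^+ 2.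
    rewrite -[leRHS]ger0_norm ?exprn_ge0// -sqrtr_sqr ler_wsqrtr//.
    by rewrite -exprM.
  have hn1 : h <= (n.+1%:R)^-1.
    by rewrite (le_trans hn)// -[leRHS]expr1 ler_wiXn2l.
  have h1 : h <= 1 by rewrite (le_trans hn1).
  have rn1 : Num.sqrt h <= (n.+1%:R)^-1.
    by rewrite (le_trans rn)// -[leRHS]expr1 ler_wiXn2l.
  have rt : Num.sqrt h * root4 R N.-1 <= (n.+1%:R)^-1.
    have r4 : root4 R N.-1 <= n.+1%:R.
      rewrite -[leRHS]ger0_norm// -sqrtr_sqr /root4 ler_wsqrtr//.
      rewrite -[leRHS]ger0_norm ?exprn_ge0// -sqrtr_sqr ler_wsqrtr// -exprM -NE.
      by rewrite ler_nat leq_pred.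
    apply: (le_trans (ler_pM (sqrtr_ge0 _) (root4_ge0 _ _) rn r4)).
    by rewrite expr2 -mulrA mulVf ?mulr1// gt_eqF.
  (* [al] and [be] collect the constant and quadratic parts of [terminal_layer] followed by Young's
     inequality at scale [s]. *)
  pose al := maxcoord x + s / 2 + h * A + h * (K%:R * C) + 4 * C * Num.sqrt h.
  pose be := (2 * s)^-1 + h * (K%:R * C).
  have KC0 : 0 <= K%:R * C by rewrite mulr_ge0 ?ltW.
  have be0 : 0 <= be 
    by rewrite addr_ge0 ?invr_ge0 ?(mulr_ge0 _ KC0) ?(ltW h0)// mulr_ge0// ltW.
  have base z : phi (1 - h) z <= al + be * sqdist x z.
    have h01 : 0 < h <= 1 by rewrite h0.
    have H1 := terminal_layer z h01.
    have H2 := maxcoord_le_sqdist x z i0 s0.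
    have H3 : `|Dt phi 0 z| <= A + K%:R * C * (1 + sqdist x z).
      (* The linear growth of [Dt phi 0] is turned into a quadratic one through [d <= 1 + d ^ 2]. *)
      have zx k : `|(z - x) ord0 k| <= 1 + sqdist x z.
        rewrite !mxE; have := sqdist_coord x z k.
        rewrite -real_normK ?num_real//; set d := `|_|.
        by have := sqr_ge0 (d - 1); have := sqr_ge0 d; rewrite sqrrB1; lra.
      have := @Dt_lipschitz 0 _ x (z - x) _ zx; rewrite lexx ltr01 => /(_ isT).
      rewrite [x + _]addrC subrK subr0 divr1 => H.
      have := ler_normD (Dt phi 0 z - Dt phi 0 x) (Dt phi 0 x); rewrite subrK -/A.
      by move=> /le_trans; apply; rewrite addrC lerD2l (le_trans H)// mulrAC.
    have H4 := ler_wpM2l (ltW h0) H3.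
    have H5 := phi_terminal z.
    have e : (sqdist x z / s + s) / 2 = (2 * s)^-1 * sqdist x z + s / 2.
      by field; rewrite gt_eqF.
    rewrite e in H2; rewrite /al /be; lra.
  have tE : 1 - t = N.-1.+1%:R * h.
    by rewrite prednK// /h mulrC divfK// gt_eqF// ltr0n.
  have := phi_le_quadratic i0 x h0 be0 base t0 tE.
  set X := sqdist x x; have -> : X = 0.
    by rewrite /X /sqdist big1// => k _; rewrite subrr expr0n.
  rewrite add0r.
  have mh : N.-1%:R * h * K%:R <= ta * K%:R.
    rewrite ler_wpM2r// -[ta]/(1 - t) tE ler_wpM2r ?ltW//.
    by rewrite ltr_nat.
  have G1 := ler_wpM2l be0 mh.
  (* Since [s ^ 2 = K * ta], the leading part of [be] gives [s / 2], which with the [s / 2] of [al]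
     makes up [s]. *)
  have G2 : be * (ta * K%:R) <= s / 2 + K%:R * C * K%:R / n.+1%:R.
    rewrite mulrDl; apply: lerD.
      by rewrite [ta * _]mulrC -ss le_eqVlt; apply/orP; left;
        apply/eqP; field; rewrite gt_eqF.
    have -> : h * (K%:R * C) * (ta * K%:R) = K%:R * C * K%:R * (h * ta) by ring.
    rewrite ler_wpM2l ?(mulr_ge0 KC0)// (le_trans _ hn1)//.
    by rewrite ler_piMr// ltW.
  have G3 := ler_wpM2l round_cst_ge0 rt.
  have G4 := ler_wpM2l (normr_ge0 _ : 0 <= A) hn1.
  have G5 := ler_wpM2l KC0 hn1.
  have G6 := ler_wpM2l (ltW hC) rn1.
  rewrite /D /al; move: G1 G2 G3 G4 G5 G6.
  move: (n.+1%:R^-1) (root4 R N.-1) (Num.sqrt h) (N.-1%:R * h * K%:R) (phi t x).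
  move=> w r4 r Y ph; move: (be) (maxcoord x) (A) (K%:R * C) (h) => b mx A' KC h'.
  clear; lra.
(* The left side of [main] does not depend on [n], so the term [D / n.+1] is removed by the
   Archimedean property. *)
rewrite leNgt; apply/negP => lt.
pose g := phi t x - (maxcoord x + s).
have g0 : 0 < g by rewrite subr_gt0.
have [n Hn] : exists n : nat, D / g < n%:R.
  exists (Num.trunc (D / g)).+1.
  by rewrite truncnS_gt.
have := main n; rewrite -lerBlDl -/g leNgt => /negP; apply.
have n0 : 0 < n.+1%:R :> R by rewrite ltr0n.
rewrite ltr_pdivrMr// mulrC -ltr_pdivrMr// (lt_trans Hn)// ltr_nat.
exact: ltnSn.
Qed.

Lemma phi_le_game_value (T : nat) (be : fore_strategy R K)
    (m0 : probability (RK R K) R) x : 'I_K -> (0 < T)%N ->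
  phi 0 ((Num.sqrt T%:R)^-1 *: x) <=
  (Num.sqrt T%:R)^-1 *
    game_value (fun n => a (n%:R / T%:R)) be (hist0 m0) T (@maxcoord R K) x
  + (Num.sqrt K%:R + 4 * round_cst) / root4 R T.
Proof.
move=> i0 T0; set p := fun n => a (n%:R / T%:R).
have T0' : 0 < T%:R :> R by rewrite ltr0n.
set q := Num.sqrt T%:R; set c := q^-1.
have q0 : 0 < q by rewrite sqrtr_gt0.
have c0 : 0 < c by rewrite invr_gt0.
have qc : q * c = 1 by rewrite mulfV// gt_eqF.
pose h : R := T%:R^-1.
have h0 : 0 < h by rewrite invr_gt0.
have hc : Num.sqrt h = c by rewrite /h sqrtrV// ltW.
have r40 : 0 < root4 R T by rewrite !sqrtr_gt0.
have cr : c = (root4 R T)^-1 ^+ 2.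
  by rewrite exprVn sqr_sqrtr ?sqrtr_ge0.
have r41 : (root4 R T)^-1 <= 1.
  rewrite invf_le1// /root4 -[leLHS]sqrtr1 ler_wsqrtr// -[leLHS]sqrtr1 ler_wsqrtr//.
  by rewrite ler1n.
have r4i0 : 0 <= (root4 R T)^-1 by rewrite invr_ge0 ltW.
have rem n m : (n + m = T)%N -> 1 - n%:R * h = m%:R * h.
  have Th : T%:R * h = 1 by rewrite mulfV// lt0r_neq0.
  by move=> nm; apply/eqP; rewrite subr_eq -mulrDl -natrD addnC nm Th.
have t0 n : 0 <= n%:R * h by rewrite mulr_ge0// ltW.
have pE n : p n = a (n%:R * h) by [].
have pb n : (n < T)%N -> balanced (p n).
  move=> nT; rewrite pE; apply: a_balanced; rewrite t0/= -subr_ge0.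
  by rewrite (rem n (T - n)%N) ?mulr_ge0 ?(ltW h0)// subnKC// ltnW.
(* The first term, equal to [sqrt (K * h)], pays for the last round by [phi_le_maxcoord]. The second
   pays for the [(T - n).-1] rounds before it. *)
pose Err n := Num.sqrt K%:R * c + round_cst * c * (4 * root4 R (T - n).-1).
(* The corrected potential is scaled back by [sqrt T] to the units of the game, and replaced by the
   true payoff at the end. *)
pose Psi n y := if (n < T)%N then q * (phi (n%:R * h) (c *: y) - Err n) else maxcoord y.
have rc0 := round_cst_ge0.
have PsiT y : Psi T y <= maxcoord y by rewrite /Psi ltnn.
have Psistep n i y : (n < T)%N ->
    Psi n y <= \sum_j p n j * Psi n.+1 (y + displacement R i j).
  move=> nT; rewrite /Psi nT.
  have := nT; rewrite leq_eqVlt => /orP[/eqP nT1|nT1].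
    rewrite nT1 ltnn.
    (* Last round: [phi] is compared with [maxcoord] before the move, and Jensen's inequality
       carries the comparison through the move. *)
    have h1E : 1 - n%:R * h = h by rewrite (rem n 1%N) ?mul1r// addn1.
    have n1 : n%:R * h < 1 by rewrite -subr_gt0 h1E.
    apply: (@le_trans _ _ (maxcoord y)); last first.
      by apply: maxcoord_mean_ge => // k; exact: displacement_mean0 (pb _ nT).
    have := @phi_le_maxcoord (n%:R * h) (c *: y) i0; rewrite t0 n1 => /(_ isT).
    rewrite h1E sqrtrM// hc maxcoordZ// => H.
    rewrite [leRHS](_ : _ = q * (c * maxcoord y)); last by rewrite mulrA qc mul1r.
    rewrite ler_wpM2l ?(ltW q0)// lerBlDr (le_trans H)//.
    rewrite lerD2l /Err lerDl mulr_ge0//; last by rewrite mulr_ge0 ?root4_ge0.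
    by rewrite mulr_ge0// ltW.
  rewrite nT1.
  have [m mE] : exists m, (n + m.+2 = T)%N 
    by exists (T - n.+2)%N; rewrite !addnS -!addSn subnKC.
  have := one_round_grid i (c *: y) (t0 n) h0 (rem _ _ mE).
  have -> : n%:R * h + h = n.+1%:R * h by rewrite -natr1 mulrDl mul1r.
  rewrite hc => H.
  have ErrS : Err n = Err n.+1 + round_cst * c * (4 * root4 R m.+1 - 4 * root4 R m).
    rewrite /Err (_ : (T - n).-1 = m.+1)%N; last by rewrite -mE addKn.
    rewrite (_ : (T - n.+1).-1 = m)%N; last by rewrite -mE addnS subSS addKn.
    ring.
  have rcc : 0 <= round_cst * c by rewrite mulr_ge0// ltW.
  have ri := ler_wpM2l rcc (root4_incr R m).
  have -> : \sum_j p n j *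
      (q * (phi (n.+1%:R * h) (c *: (y + displacement R i j)) - Err n.+1)) =
     q * ((\sum_j a (n%:R * h) j * phi (n.+1%:R * h) (c *: y + c *: displacement R i j))
      - Err n.+1 * \sum_j p n j).
    rewrite mulr_sumr -sumrB mulr_sumr; apply: eq_bigr => j _.
    rewrite scalerDr -pE; ring.
  rewrite fdist_sum1 mulr1 ler_wpM2l ?(ltW q0)//.
  rewrite lerBrDr (le_trans _ H)// ErrS.
  move: ri; rewrite !mulrDr; move: (_ / m.+1%:R) => w; lra.
have := @game_value_ge R K p be T Psi (@maxcoord R K) PsiT Psistep T 0%N (hist0 m0) x
  (add0n _).
rewrite /Psi T0 mul0r; set G := game_value _ _ _ _ _ _ => H.
have := ler_wpM2l (ltW c0) H; rewrite mulrA [c * q]mulrC qc mul1r lerBlDr.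
move=> /le_trans; apply; rewrite lerD2l /Err subn0.
(* Both parts of [Err 0] are at most of order [T ^ (-1/4)], because [c] is the square of
   [(root4 R T)^-1]. *)
have cr4 : c <= (root4 R T)^-1.
  by rewrite cr expr2 ler_piMl.
have crr : c * root4 R T.-1 <= (root4 R T)^-1.
  apply: (@le_trans _ _ (c * root4 R T)).
    by rewrite ler_wpM2l ?(ltW c0)// !ler_wsqrtr// ler_nat leq_pred.
  by rewrite cr expr2 -mulrA mulVf ?mulr1// gt_eqF.
have := ler_wpM2l (sqrtr_ge0 K%:R) cr4; have := ler_wpM2l rc0 crr.
move: (root4 R T)^-1 (root4 R T.-1) => u v; lra.
Qed.

End growth_bounds.

Theorem proposition5p1 (R : realType) (K : nat) (hK : (2 <= K)%N)
  (a : R -> fdist R {set 'I_K})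
  (a_balanced : forall t : R, 0 <= t <= 1 -> balanced (a t))
  (phi : R -> 'rV[R]_K -> R)
  (phi_classical : classical_C12 phi)
  (phi_higher : has_higher_derivatives phi)
  (phi_pde : pde_subsolution a phi)
  (phi_terminal : forall x : 'rV[R]_K, phi 1 x <= maxcoord x)
  (phi_translation : forall (t : R) (x : 'rV[R]_K) (l : R), 0 <= t <= 1 ->
     phi t (x + l *: ones R K) = phi t x + l)
  (C : R) (hC : 0 < C)
  (phi_tt : forall (t : R) (x : 'rV[R]_K), 0 <= t < 1 ->
     `|Dt (Dt phi) t x| <= C / (1 - t) `^ (3 / 2))
  (phi_xxx_tx : forall (t : R) (x : 'rV[R]_K), 0 <= t < 1 ->
     norm_Dxxx phi t x + norm_Dtx phi t x <= C / (1 - t))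
  (m0 : probability (RK R K) R)
  (m0_integrable : m0.-integrable [set: RK R K]
     (fun x : RK R K => (maxcoord x)%:E)) :
  (0 <= limn_einf (fun T : nat =>
     ((Num.sqrt T%:R)^-1)%R%:E * inf_regret T m0 (alpha_star a T)
     - scaled_integral m0 (Num.sqrt T%:R)^-1%R (phi 0%R)))%E.
Proof.
have i0 : 'I_K := Ordinal (ltnW hK).
(* The constant is the one of [phi_le_game_value], where the error is uniform in the forecaster and
   in the initial state. *)
apply: (@limn_einf_ge0 _ _ (Num.sqrt K%:R + 4 * round_cst K C)).
  by rewrite addr_ge0 ?sqrtr_ge0// mulr_ge0// round_cst_ge0.
move=> T T0.
apply: (@integral_le_inf_regret R K i0 m0 m0_integrable (fun n => a (n%:R / T%:R)) T
  _ (fun x => phi 0 ((Num.sqrt T%:R)^-1 *: x))) => //.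
- move=> n nT; apply: a_balanced; rewrite divr_ge0//= ler_pdivrMr ?ltr0n//.
  by rewrite mul1r ler_nat ltnW.
- have c0 : continuous (phi 0).
    apply: (@continuous_on_space R K _ phi 0 (classical_cont phi_classical)).
    by rewrite /= in_itv/= lexx ler01.
  move=> x; exact: (@cvg_comp _ _ _ (fun y => (Num.sqrt T%:R)^-1 *: y) (phi 0) _ _ _
    (@continuous_scaler R K _ x) (c0 _)).
- by move=> be x; apply: phi_le_game_value.
Qed.
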